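(* Let $\Sigma=S_{g,b}$ be the orientable surface of genus $g$ with $b$ boundary components. Then there exists a finite graph $G_\Sigma$ that is not isomorphic to any induced subgraph of the fine curve graph $\mathcal{C}^\dagger(\Sigma)$.
   Context: The fine curve graph $\mathcal{C}^\dagger(\Sigma)$ is the graph whose vertices are the embedded simple closed essential curves in $\Sigma$ (actual curves, not isotopy classes), with two distinct vertices joined by an edge if and only if the curves are disjoint. *)

(* Defs.v *)
From HB Require Import structures.
From mathcomp Require Import all_boot all_order all_algebra.
From mathcomp Require Import all_classical all_reals all_analysis.
Set Implicit Arguments. Unset Strict Implicit. Unset Printing Implicit Defensive.
Import Order.TTheory GRing.Theory Num.Theory.
Import numFieldTopology.Exports numFieldNormedType.Exports.
Local Open Scope classical_set_scope.
Local Open Scope ring_scope.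

(* Concrete model of the compact orientable surface S_{g,b} in R^3.
   Let D be the closed disk of radius Rg centred at 0, minus the g open unit
   disks centred at (4i,0), 1 <= i <= g.  The function q is < 0 exactly on the
   interior of D, > 0 off D, and has nonzero gradient on its zero set, so
   { z^2 + q(x,y) = 0 } is the double of D, a closed orientable surface of
   genus g.  S_{g,b} is obtained by removing b disjoint open disks from the
   upper sheet: the points with z > 0 and (x,y) in the open unit disk centred
   at (0,4j), 1 <= j <= b. *)
Section Surface.
Variable R : realType.

Local Notation pt := (R * R * R)%type.

Definition Rg (g b : nat) : R := (4 * (g + b) + 10)%:R.

Definition qfun (g b : nat) (x y : R) : R :=
  (-1) ^+ g * (x ^+ 2 + y ^+ 2 - Rg g b ^+ 2) *
  \prod_(1 <= i < g.+1) (1 - (x - (4 * i)%:R) ^+ 2 - y ^+ 2).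

Definition closed_surface (g b : nat) : set pt :=
  [set p | p.2 ^+ 2 + qfun g b p.1.1 p.1.2 = 0].

Definition surface (g b : nat) : set pt :=
  [set p | closed_surface g b p /\
     ~ (exists j : nat, [/\ (1 <= j <= b)%N, 0 < p.2 &
           p.1.1 ^+ 2 + (p.1.2 - (4 * j)%:R) ^+ 2 < 1])].

Definition boundary_comp (g b j : nat) : set pt :=
  [set p | [/\ closed_surface g b p, 0 < p.2 &
     p.1.1 ^+ 2 + (p.1.2 - (4 * j)%:R) ^+ 2 = 1]].

Definition I01 : set R := [set t | 0 <= t <= 1].

Definition loop_in (S : set pt) (gam : R -> pt) : Prop :=
  [/\ {within I01, continuous gam}, gam 0 = gam 1 &
      forall t, I01 t -> S (gam t)].

Definition simple_loop_in (S : set pt) (gam : R -> pt) : Prop :=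
  loop_in S gam /\
  forall s t, 0 <= s < 1 -> 0 <= t < 1 -> gam s = gam t -> s = t.

Definition freely_homotopic (S : set pt) (gam del : R -> pt) : Prop :=
  exists H : R * R -> pt,
    [/\ {within I01 `*` I01, continuous H},
        (forall s t, I01 s -> I01 t -> S (H (s, t))),
        (forall s, I01 s -> H (s, 0) = gam s /\ H (s, 1) = del s) &
        (forall t, I01 t -> H (0, t) = H (1, t))].

Definition simple_closed_curve (g b : nat) (C : set pt) : Prop :=
  exists gam, simple_loop_in (surface g b) gam /\ gam @` I01 = C.

Definition essential_curve (g b : nat) (C : set pt) : Prop :=
  exists gam, [/\ simple_loop_in (surface g b) gam, gam @` I01 = C,
    ~ (exists c : pt, freely_homotopic (surface g b) gam (fun _ => c)) &
    ~ (exists (j : nat) (del : R -> pt),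
         [/\ (1 <= j <= b)%N, simple_loop_in (surface g b) del,
             del @` I01 = boundary_comp g b j &
             freely_homotopic (surface g b) gam del])].

Definition fine_curve_adj (C D : set pt) : Prop := C <> D /\ C `&` D = set0.

Definition induced_subgraph_of_fine_curve_graph (g b : nat)
    (V : finType) (e : rel V) : Prop :=
  exists f : V -> set pt,
    [/\ injective f, (forall v, essential_curve g b (f v)) &
        (forall u v, e u v <-> fine_curve_adj (f u) (f v))].

End Surface.

(* Main.v *)
Require Import Defs.
From HB Require Import structures.
From mathcomp Require Import all_boot all_order all_algebra.
From mathcomp Require Import all_classical all_reals all_analysis.
From mathcomp Require Import ring lra zify.
Set Implicit Arguments. Unset Strict Implicit. Unset Printing Implicit Defensive.
Import Order.TTheory GRing.Theory Num.Theory.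
Import numFieldTopology.Exports numFieldNormedType.Exports.
Local Open Scope ring_scope.

(** The obstruction is the complement of the 1-subdivision of a large complete
    bipartite graph K_{m+1,m+1}: curves realising it would intersect exactly as the
    vertices and edges of K_{m+1,m+1} are incident. Replace every curve by the set of
    vertices near it in a fine grid on the surface. This gives a K_{m+1,m+1} minor of
    the 1-skeleton of a 2-complex in which each edge lies on at most two cells and in
    which, whatever the mesh, a cycle over F_2 is a boundary as soon as 4g+2 linear
    functionals vanish on it. Then an Euler type count concludes: the cycle space of
    K_{m+1,m+1} contains m^2 independent 4-cycles, so the face boundaries span
    dimension at least m^2 - (4g+2); a nonzero face boundary uses at least 3 edges of
    K_{m+1,m+1} and an edge is used at most twice, so
    3 (m^2 - (4g+2)) <= 2 (m+1)^2, which fails for large m. *)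

(** * Bipartite minors of 2-complexes over F_2 *)

(** Adjacency in the fine curve graph is disjointness, hence the complement: distinct non-adjacent
    vertices must go to curves that intersect. The subdivision matters because a plain complete
    bipartite intersection pattern is already realised by horizontal and vertical segments; giving
    each edge its own curve, which meets only the curves of its two ends, turns intersections into
    incidences. The obstacle is that two topological curves may meet in an infinite, even
    Cantor-like, set, so their intersections do not cut them into finitely many arcs. In a finite
    grid, a path can be followed up to its first vertex in another set, and this yields the branch
    sets of a minor. The number 4g+2 comes from slicing the closed surface by the planes x = const.
    A section is made of two arcs glued along two seams, and the axis splits into 2g+1 runs on which
    the gluing pattern is constant; each seam of each run contributes one functional. The final
    inequality is decided by the leading coefficients in m, 3 against 2; the functionals only
    contribute a constant. *)

Lemma F2_addxx (x : 'F_2) : x + x = 0.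
Proof. by apply/val_inj; case: x => [[|[|]]]. Qed.

Lemma F2_neq0 (x : 'F_2) : (x != 0) = (x == 1).
Proof. by case: x => [[|[|]]]. Qed.

Lemma F2_addr_eq0 (x y : 'F_2) : x + y = 0 -> x = y.
Proof. by move=> h; rewrite -[x]addr0 -(F2_addxx y) addrA h add0r. Qed.

(** * Ranks of sparse matrices *)

Lemma rank_le_nonzero_rows (K : fieldType) (p q : nat) (G : 'M[K]_(p, q)) :
  (\rank G <= #|[set i | row i G != 0%R]|)%N.
Proof.
have sG : (G <= \sum_(i in [set i | row i G != 0%R]) <<row i G>>)%MS.
  apply/row_subP => i; have [->|nz] := eqVneq (row i G) 0; first exact: sub0mx.
  by apply: (sumsmx_sup i); rewrite ?inE // genmxE.
apply: leq_trans (mxrankS sG) _.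
apply: leq_trans (mxrank_sum_leqif _).1 _ => /=.
rewrite -sum1_card; apply: leq_sum => i _; rewrite genmxE; exact: rank_leq_row.
Qed.

(** Double counting of the nonzero entries: the rank is at most the number of nonzero rows, each of
    which holds at least [a] of them, while a column holds at most [b]. *)
Lemma rank_le_sparse (K : fieldType) (p q : nat) (G : 'M[K]_(p, q)) (a b : nat) :
  (forall j, (#|[set i | G i j != 0%R]| <= b)%N) ->
  (forall i j, G i j != 0 -> (a <= #|[set j | G i j != 0%R]|)%N) ->
  (a * \rank G <= b * q)%N.
Proof.
move=> colw roww.
apply: leq_trans (leq_mul (leqnn a) (rank_le_nonzero_rows G)) _.
apply: (@leq_trans (\sum_(i < p) #|[set j | G i j != 0%R]|)).
  rewrite [leqRHS](bigID (fun i => row i G != 0)) /=; apply: leq_trans (leq_addr _ _).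
  rewrite mulnC -sum_nat_const.
  under eq_bigl do rewrite inE.
  apply: leq_sum => i /eqP/rowP nz.
  have [j nzj] : exists j, G i j != 0.
    apply/existsP/contraT; rewrite negb_exists => /forallP z.
    by case: nz => j; rewrite !mxE; apply/eqP/negPn.
  exact: roww nzj.
have -> : \sum_(i < p) #|[set j | G i j != 0%R]| = \sum_(j < q) #|[set i | G i j != 0%R]|.
  under eq_bigr do rewrite -sum1dep_card big_mkcond.
  rewrite exchange_big /=.
  by apply: eq_bigr => j _; rewrite -sum1dep_card [in RHS]big_mkcond.
apply: leq_trans (leq_sum _ (fun j _ => colw j)) _.
by rewrite sum_nat_const card_ord mulnC.
Qed.

(** * Chains, cycles and connected vertex sets *)

Section Complex.
Variables (V E F : finType) (src tgt : E -> V) (D : F -> E -> 'F_2).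

Definition coboundary (phi : V -> 'F_2) (e : E) : 'F_2 := phi (src e) + phi (tgt e).

(* A cycle is described by duality: it pairs to 0 with every coboundary. *)
Definition is_cycle (z : E -> 'F_2) : Prop :=
  forall phi, \sum_e z e * coboundary phi e = 0.

Definition joins (e : E) (x y : V) : bool :=
  ((src e == x) && (tgt e == y)) || ((src e == y) && (tgt e == x)).

Variable good : pred E.

Definition adj_in (A : {set V}) : rel V :=
  fun x y => [&& x \in A, y \in A & [exists e, good e && joins e x y]].

Definition connected_in (A : {set V}) : Prop :=
  forall x y, x \in A -> y \in A -> connect (adj_in A) x y.

Lemma adj_in_sym (A : {set V}) : symmetric (adj_in A).
Proof.
move=> x y; rewrite /adj_in andbCA; congr [&& _, _ & _].
by apply: eq_existsb => e; rewrite /joins orbC.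
Qed.

Lemma connect_in_sym (A : {set V}) : connect_sym (adj_in A).
Proof. exact/sym_connect_sym/adj_in_sym. Qed.

Lemma joins_coboundary e x y phi : joins e x y -> coboundary phi e = phi x + phi y.
Proof. by rewrite /coboundary => /orP[] /andP[/eqP-> /eqP->] //; rewrite addrC. Qed.

(** The chain is the sum mod 2 of the edges of a path; its boundary is expressed by duality, to
    match [is_cycle]. *)
Lemma path_chain (A : {set V}) x y :
  connect (adj_in A) x y ->
  exists c : E -> 'F_2,
    (forall e, c e != 0 -> [&& good e, src e \in A & tgt e \in A]) /\
    (forall phi, \sum_e c e * coboundary phi e = phi x + phi y).
Proof.
move=> /connectP[p]; elim: p x => [|x' p IHp] x /=.
  move=> _ ->; exists (fun=> 0); split=> [e|phi]; first by rewrite eqxx.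
  by rewrite F2_addxx big1 // => e _; rewrite mul0r.
move=> /andP[/and3P[xA xA' /existsP[e0 /andP[ge0 je0]]] pth] lasty.
have [c [cS cB]] := IHp _ pth lasty.
exists (fun e => c e + (e == e0)%:R); split=> [e|phi].
  have [->|ne] := eqVneq e e0; last by rewrite addr0; apply: cS.
  rewrite ge0 => _; move: je0 => /orP[] /andP[/eqP-> /eqP->]; rewrite ?xA ?xA' //.
under eq_bigr do rewrite mulrDl.
rewrite big_split /= cB (bigD1 e0) //= big1 => [|e /negPf ne]; last by rewrite ne mul0r.
rewrite eqxx mul1r addr0 (joins_coboundary _ je0).
by rewrite addrC -addrA (addrA (phi x')) F2_addxx add0r.
Qed.


(** * Dimension count for a bipartite minor *)

Section MinorBound.
Variables (h : finType) (lam : h -> E -> 'F_2) (m : nat).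
Local Notation I := 'I_m.+1.
Variables (B : bool * I -> {set V}) (d : I * I -> E) (s t : I * I -> V).
Hypothesis D_le2 : forall e, (#|[set f | D f e != 0%R]| <= 2)%N.
Hypothesis D_cycle : forall f, is_cycle (D f).
Hypothesis boundaryP : forall z, is_cycle z -> (forall e, z e != 0 -> good e) ->
  (forall b, \sum_e lam b e * z e = 0) ->
  exists S : F -> 'F_2, forall e, z e = \sum_f S f * D f e.
Hypothesis B_disj : forall l l' x, x \in B l -> x \in B l' -> l = l'.
Hypothesis B_conn : forall l, connected_in (B l).
Hypothesis d_good : forall p, good (d p).
Hypothesis d_joins : forall p, joins (d p) (s p) (t p).
Hypothesis s_in : forall p, s p \in B (true, p.1).
Hypothesis t_in : forall p, t p \in B (false, p.2).

Let internal e := [exists l, (src e \in B l) && (tgt e \in B l)].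
(** The subgraph H made of the good edges inside branch sets and of the chosen edges [d p];
    contracting the branch sets turns it into K_{m+1,m+1}. *)
Let inH e := good e && (internal e || (e \in codom d)).

Let d_cob p phi : coboundary phi (d p) = phi (s p) + phi (t p).
Proof. exact: joins_coboundary. Qed.

Let st_disj p q : s p != t q.
Proof.
apply/eqP => e; have := s_in p; rewrite e => /B_disj/(_ (t_in q)).
by case.
Qed.

Let d_ext p : ~~ internal (d p).
Proof.
have no l : s p \in B l -> t p \in B l -> False.
  by move=> /B_disj/(_ (s_in p)) -> /B_disj/(_ (t_in p)).
apply/existsP => -[l /andP[]].
by case/orP: (d_joins p) => /andP[/eqP-> /eqP->] h1 h2; apply: (@no l).
Qed.

Let d_inj : injective d.
Proof.
move=> p q dpq; have := d_joins p; rewrite dpq /joins.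
have s_inj : s q = s p -> q.1 = p.1.
  by move=> e; have := s_in q; rewrite e => /B_disj/(_ (s_in p)) [].
have t_inj : t q = t p -> q.2 = p.2.
  by move=> e; have := t_in q; rewrite e => /B_disj/(_ (t_in p)) [].
have st := negPf (st_disj _ _).
case/orP: (d_joins q) => /andP[/eqP-> /eqP->] /orP[] /andP[].
- by move=> /eqP/s_inj e1 /eqP/t_inj e2; apply/pair_eqP; rewrite /pair_eq e1 e2 !eqxx.
- by rewrite st.
- by rewrite eq_sym st.
- by move=> /eqP/t_inj e1 /eqP/s_inj e2; apply/pair_eqP; rewrite /pair_eq e1 e2 !eqxx.
Qed.

Let inH_d p : inH (d p).
Proof. by rewrite /inH d_good codom_f orbT. Qed.

Let delta_cob p phi : \sum_e (e == d p)%:R * coboundary phi e = phi (s p) + phi (t p).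
Proof.
rewrite (bigD1 (d p)) //= eqxx mul1r big1 ?addr0 // => e /negPf ->.
by rewrite mul0r.
Qed.

(** Lift of the 4-cycle of K_{m+1,m+1} on the left vertices u0, u and the right vertices v0, v: its
    edges [d] are linked by paths inside the four branch sets. *)
Let lift_square (u0 v0 u v : I) : exists z : E -> 'F_2,
  [/\ is_cycle z, forall e, z e != 0 -> inH e &
      forall p, z (d p) = (p == (u0, v0))%:R + (p == (u0, v))%:R
                          + (p == (u, v0))%:R + (p == (u, v))%:R].
Proof.
have [c1 [S1 B1]] := path_chain (B_conn (s_in (u0, v0)) (s_in (u0, v))).
have [c2 [S2 B2]] := path_chain (B_conn (s_in (u, v0)) (s_in (u, v))).
have [c3 [S3 B3]] := path_chain (B_conn (t_in (u0, v0)) (t_in (u, v0))).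
have [c4 [S4 B4]] := path_chain (B_conn (t_in (u0, v)) (t_in (u, v))).
have c0 c l p : (forall e, c e != 0 -> [&& good e, src e \in B l & tgt e \in B l]) ->
    c (d p) = 0 :> 'F_2.
  move=> S; apply/eqP/negPn/negP => /S /and3P[_ h1 h2].
  by have /existsP[] := d_ext p; exists l; rewrite h1.
have cH c l e : (forall e, c e != 0 :> 'F_2 -> [&& good e, src e \in B l & tgt e \in B l]) ->
    c e != 0 -> inH e.
  move=> S /S /and3P[ge h1 h2]; rewrite /inH ge /=; apply/orP; left.
  by apply/existsP; exists l; rewrite h1.
exists (fun e => (e == d (u0, v0))%:R + (e == d (u0, v))%:R + (e == d (u, v0))%:R
   + (e == d (u, v))%:R + c1 e + c2 e + c3 e + c4 e); split=> [phi|e|p].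
- under eq_bigr do rewrite !mulrDl.
  rewrite !big_split /= !delta_cob B1 B2 B3 B4 /=.
  set a := phi (s (u0, v0)); set a' := phi (t (u0, v0)).
  set b := phi (s (u0, v)); set b' := phi (t (u0, v)).
  set c := phi (s (u, v0)); set c' := phi (t (u, v0)).
  set e := phi (s (u, v)); set e' := phi (t (u, v)).
  rewrite -[RHS](F2_addxx (a + a' + b + b' + c + c' + e + e')); ring.
- apply: contraR => nH.
  have nd p : e == d p = false by apply: contraNF nH => /eqP->; apply: inH_d.
  have z c l : (forall e, c e != 0 :> 'F_2 -> [&& good e, src e \in B l & tgt e \in B l]) ->
    c e = 0 by move=> S; apply/eqP; apply: contraNT nH; apply: cH S.
  by rewrite !nd (z _ _ S1) (z _ _ S2) (z _ _ S3) (z _ _ S4) !addr0.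
- by rewrite (c0 _ _ _ S1) (c0 _ _ _ S2) (c0 _ _ _ S3) (c0 _ _ _ S4) !addr0 !(inj_eq d_inj).
Qed.

(** The cycle condition is tested on the indicator of [B l]. Internal edges cancel, so only the
    edges [d p] leaving [B l] count: after contraction, [g] has even degree at every vertex. *)
Let crossing_sum g l : is_cycle g -> (forall e, g e != 0 -> inH e) ->
  \sum_p g (d p) * ((s p \in B l)%:R + (t p \in B l)%:R) = 0.
Proof.
move=> gcyc gH; rewrite -[RHS](gcyc (fun x => (x \in B l)%:R)).
rewrite [RHS](bigID (mem (d @: finset.setT))) /= [X in _ = _ + X]big1 => [|e nd]; last first.
  have [->|/gH] := eqVneq (g e) 0; first by rewrite mul0r.
  rewrite /inH => /andP[_ /orP[/existsP[l' /andP[h1 h2]]|/codomP[p ep]]]; last first.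
    by move: nd; rewrite ep imset_f.
  rewrite /coboundary; have [->|ne] := eqVneq l l'; first by rewrite h1 h2 F2_addxx mulr0.
  have no x : x \in B l' -> x \in B l = false.
    by move=> xl'; apply: contraNF ne => xl; rewrite (B_disj xl xl').
  by rewrite !no // addr0 mulr0.
rewrite addr0 big_imset /= => [|p q _ _]; last exact: d_inj.
by apply: eq_big => [p|p _]; rewrite ?inE // d_cob.
Qed.

(** Even degree at both ends of the edge (u, v) provides a second edge at u and a second edge at v.
    The value 3 suffices because it exceeds 2, the number of cells allowed on an edge. *)
Let weight_ge3 g p0 : is_cycle g -> (forall e, g e != 0 -> inH e) -> g (d p0) != 0 ->
  (3 <= #|[set p | g (d p) != 0%R]|)%N.
Proof.
move: p0 => [u v] gcyc gH nz.
have inB b' w x l : x \in B (b', w) -> (x \in B l) = (l == (b', w)).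
  by move=> xB; apply/idP/eqP => [/B_disj/(_ xB)|->].
have [v' nv gv] : exists2 v', v' != v & g (d (u, v')) != 0.
  apply/exists_inP; apply: contraNT nz; rewrite negb_exists_in => /forall_inP no.
  have := crossing_sum (true, u) gcyc gH.
  rewrite (bigD1 (u, v)) //= big1 => [|[u' v'] ne].
    rewrite (inB _ _ _ _ (s_in _)) (inB _ _ _ _ (t_in _)) /= eqxx !addr0 mulr1.
    by move->.
  rewrite (inB _ _ _ _ (s_in _)) (inB _ _ _ _ (t_in _)) /= addr0 xpair_eqE eqxx /=.
  have [eu|_] := eqVneq u u'; last by rewrite mulr0.
  rewrite mulr1; subst u'; apply/eqP/negPn/no.
  by apply: contraNneq ne => ->.
have [u' nu gu] : exists2 u', u' != u & g (d (u', v)) != 0.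
  apply/exists_inP; apply: contraNT nz; rewrite negb_exists_in => /forall_inP no.
  have := crossing_sum (false, v) gcyc gH.
  rewrite (bigD1 (u, v)) //= big1 => [|[u' v''] ne].
    rewrite (inB _ _ _ _ (s_in _)) (inB _ _ _ _ (t_in _)) /= eqxx add0r addr0 mulr1.
    by move->.
  rewrite (inB _ _ _ _ (s_in _)) (inB _ _ _ _ (t_in _)) /= add0r xpair_eqE eqxx /=.
  have [ev|_] := eqVneq v v''; last by rewrite mulr0.
  rewrite mulr1; subst v''; apply/eqP/negPn/no.
  by apply: contraNneq ne => ->.
apply: (@leq_trans #|[set (u, v); (u, v'); (u', v)]|).
  rewrite finset.setUC cardsU1 cards2 !inE !xpair_eqE !eqxx (negPf nu) /=.
  by rewrite (eq_sym v) (negPf nv).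
by apply/subset_leq_card/fintype.subsetP => p; rewrite !inE => /orP[/orP[]|] /eqP->.
Qed.

(* The faces of the subgraph H: cells glued together across the edges outside H.
   As an edge has at most two cells, every chain of cells with boundary in H is
   constant on faces; a face having a boundary edge of the complex outside H
   (i.e. failing okc) cannot occur in such a chain. *)
Let fadj : rel F := fun f f' => [exists e, [&& ~~ inH e, D f e != 0 & D f' e != 0]].

Let fadj_sym : connect_sym fadj.
Proof.
apply: sym_connect_sym => f f'; apply: eq_existsb => e; congr (_ && _).
exact: andbC.
Qed.

Let cls (f : F) : F := fingraph.root fadj f.
Let gsum r e := \sum_(f | cls f == r) D f e.
Let okc r := [forall e, inH e || (gsum r e == 0)].

Let cls_const (S : F -> 'F_2) z : (forall e, z e = \sum_f S f * D f e) ->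
   (forall e, z e != 0 -> inH e) ->
  forall f f', cls f = cls f' -> S f = S f' :> 'F_2.
Proof.
move=> zS zH f f' /eqP; rewrite /cls root_connect // => /connectP[p].
elim: p f => [|f1 p IHp] f /=; first by move=> _ ->.
move=> /andP[/existsP[e /and3P[nH n1 n2]] pth] l; rewrite -(IHp _ pth l).
have [->//|ne] := eqVneq f f1.
(* No third cell contains [e], so [z e] is the sum of the coefficients of [f] and [f1]; it vanishes
   as [e] is outside H. *)
have z0 : z e = 0 by apply/eqP/negPn; apply: contra nH; apply: zH.
move: (zS e); rewrite z0 (bigD1 f) //= (bigD1 f1) 1?eq_sym //= big1 => [|f2 /andP[n3 n4]].
  by move: n1 n2; rewrite !F2_neq0 => /eqP-> /eqP->; rewrite !mulr1 addr0 => /esym/F2_addr_eq0.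
have [->|nz] := eqVneq (D f2 e) 0; first by rewrite mulr0.
have := D_le2 e; rewrite leqNgt => /negP[].
apply: (@leq_trans #|[set f2; f; f1]|).
  by rewrite finset.setUC cardsU1 cards2 !inE n3 (eq_sym f1 f) (negPf ne) (eq_sym f1 f2) (negPf n4).
by apply/subset_leq_card/fintype.subsetP => f3; rewrite !inE => /orP[/orP[]|] /eqP->.
Qed.

Let cls_ok (S : F -> 'F_2) z r : (forall e, z e = \sum_f S f * D f e) ->
  (forall e, z e != 0 -> inH e) ->
  ~~ okc r -> forall f, cls f = r -> S f = 0.
Proof.
move=> zS zH /forallPn[e]; rewrite negb_or => /andP[nH nz] f fr.
have z0 : z e = 0 by apply/eqP/negPn; apply: contra nH; apply: zH.
have [f1 f1r n1] : exists2 f1, cls f1 = r & D f1 e != 0.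
  have [f1 /andP[/eqP ? ?]|no] := pickP (fun f => (cls f == r) && (D f e != 0)).
    by exists f1.
  case/eqP: nz; apply: big1 => f1 f1r; have := no f1; rewrite f1r /=.
  by move/negbFE/eqP.
move: (zS e); rewrite z0 (bigID (fun f => cls f == r)) /= [X in _ + X]big1 => [|f2 ne].
  rewrite (eq_bigr (fun f2 => S f * D f2 e)) => [|f2 /eqP f2r]; last first.
    by rewrite (cls_const zS zH (f' := f)) // fr.
  rewrite -mulr_sumr addr0 -/(gsum r e) => /esym/eqP.
  by rewrite mulf_eq0 (negPf nz) orbF => /eqP.
have [->|nz2] := eqVneq (D f2 e) 0; first by rewrite mulr0.
case/negP: ne; rewrite -f1r root_connect // connect1 //.
by apply/existsP; exists e; rewrite nH nz2.
Qed.

(* The m^2 cycles through (0,0), (0,v), (u,v), (u,0) are independent; those in the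
   common kernel of lam are sums of the at most 2(m+1)^2/3 nonzero rows of G. *)
Theorem bipartite_minor_bound : (3 * m ^ 2 <= 3 * #|h| + 2 * m.+1 ^ 2)%N.
Proof.
have /fin_all_exists[zz zzP] : forall q : 'I_m * 'I_m, exists z : E -> 'F_2,
  [/\ is_cycle z, forall e, z e != 0 -> inH e &
      forall p, z (d p) = (p == (ord0, ord0))%:R + (p == (ord0, lift ord0 q.2))%:R
         + (p == (lift ord0 q.1, ord0))%:R + (p == (lift ord0 q.1, lift ord0 q.2))%:R].
  by move=> q; apply: lift_square.
pose nq := #|{: 'I_m * 'I_m}|; pose np := #|{: I * I}|.
pose L : 'M['F_2]_(nq, #|h|) :=
  \matrix_(i, j) \sum_e lam (enum_val j) e * zz (enum_val i) e.
pose T : 'M['F_2]_(nq, np) := \matrix_(i, j) zz (enum_val i) (d (enum_val j)).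
pose G : 'M['F_2]_(#|F|, np) :=
  \matrix_(i, j) if okc (enum_val i) then gsum (enum_val i) (d (enum_val j)) else 0.
(* A combination of lifted squares killed by all functionals is a boundary, hence constant on faces
   and zero on those failing [okc]; on the edges [d p] it is therefore a combination of rows of
   [G]. *)
have sub : (kermx L *m T <= G)%MS.
  apply/row_subP => i; rewrite row_mul; set c := row i _.
  have cL : c *m L = 0 by rewrite -row_mul mulmx_ker row0.
  pose z e := \sum_i c 0 i * zz (enum_val i) e.
  have zcyc : is_cycle z.
    move=> phi; under eq_bigr do rewrite mulr_suml.
    rewrite exchange_big big1 //= => j _.
    under eq_bigr do rewrite -mulrA.
    by rewrite -mulr_sumr; have [-> _ _] := zzP (enum_val j); rewrite mulr0.
  have zH e : z e != 0 -> inH e.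
    apply: contraR => nH; rewrite /z big1 // => j _.
    have [_ zj _] := zzP (enum_val j).
    by apply/eqP; rewrite mulf_eq0 orbC; apply/orP; left; apply: contraNT nH; apply: zj.
  have zlam b : \sum_e lam b e * z e = 0.
    have /rowP/(_ (enum_rank b)) := cL; rewrite !mxE => c0; rewrite -[RHS]c0 /z.
    under eq_bigr do rewrite mulr_sumr.
    rewrite exchange_big /=; apply: eq_bigr => j _; rewrite [L _ _]mxE enum_rankK mulr_sumr.
    by apply: eq_bigr => e _; rewrite mulrCA.
  have [S zS] := boundaryP zcyc (fun e nz => proj1 (andP (zH e nz))) zlam.
  have -> : c *m T = (\row_i S (enum_val i)) *m G; last exact: submxMl.
  apply/rowP => j; rewrite [LHS]mxE [RHS]mxE; set p := enum_val j.
  transitivity (z (d p)); first by apply: eq_bigr => k _; rewrite [T _ _]mxE.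
  rewrite zS (partition_big cls xpredT) //= [RHS](reindex enum_rank) /=; last first.
    by apply: onW_bij; apply: enum_rank_bij.
  apply: eq_bigr => r _; rewrite !mxE enum_rankK -/p.
  case: ifPn => [ok|nok]; last first.
    by rewrite mulr0 big1 // => f /eqP/(cls_ok zS zH nok)->; rewrite mul0r.
  rewrite mulr_sumr; apply: eq_bigr => f /eqP fr; congr (_ * _).
  by apply: (cls_const zS zH); rewrite -fr /cls root_root.
(* An edge (u, v) with both indices nonzero lies on exactly one of the chosen 4-cycles, which gives
   a right inverse of [T]. *)
have Tfree : row_free T.
  apply/row_freeP; exists (\matrix_(j, i)
    (enum_val j == (lift ord0 (enum_val i).1, lift ord0 (enum_val i).2))%:R).
  apply/matrixP => i k; rewrite !mxE; set q := enum_val k.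
  rewrite (bigD1 (enum_rank (lift ord0 q.1, lift ord0 q.2))) //= !mxE enum_rankK eqxx mulr1.
  rewrite big1 ?addr0 => [|j nj]; last first.
    rewrite !mxE; have [e|_] := eqVneq; last by rewrite mulr0.
    by case/eqP: nj; rewrite -e enum_valK.
  have [_ _ ->] := zzP (enum_val i).
  rewrite !xpair_eqE !(inj_eq lift_inj) /= !(eq_sym (lift _ _) ord0) /=.
  rewrite ?andbF ?addr0 ?add0r -(inj_eq enum_val_inj) -/q.
  by case: (enum_val i) q => a b [a' b']; rewrite xpair_eqE /= (eq_sym a) (eq_sym b).
have rk : (nq - #|h| <= \rank G)%N.
  apply: leq_trans (mxrankS sub); rewrite mxrankMfree // mxrank_ker.
  by rewrite leq_sub2l // rank_leq_col.
have Gb : (3 * \rank G <= 2 * np)%N.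
  apply: rank_le_sparse => [j|i j].
    apply: leq_trans (D_le2 (d (enum_val j))).
    apply: leq_trans (leq_imset_card cls _).
    rewrite -(card_imset _ enum_val_inj); apply/subset_leq_card/fintype.subsetP => r.
    case/imsetP => i; rewrite inE mxE => nz ->; move: nz.
    case: ifP => [_ nz|_]; last by rewrite eqxx.
    have [f /andP[/eqP fr nf]|no] := pickP (fun f =>
      (cls f == enum_val i) && (D f (d (enum_val j)) != 0)).
      by apply/imsetP; exists f; rewrite ?inE.
    case/eqP: nz; apply: big1 => f fr; have := no f; rewrite fr /=.
    by move/negbFE/eqP.
  rewrite mxE; case: ifP => [ok nz|_]; last by rewrite eqxx.
  set r := enum_val i.
  apply: leq_trans (weight_ge3 (g := gsum r) _ _ nz) _.
  - move=> phi; under eq_bigr do rewrite mulr_suml.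
    by rewrite exchange_big big1 //= => f _; apply: D_cycle.
  - by move=> e nze; have /forallP/(_ e) := ok; rewrite (negPf nze) orbF.
  - rewrite -(card_imset _ enum_rank_inj); apply/subset_leq_card/fintype.subsetP => k.
    by case/imsetP => p; rewrite !inE => nz' ->; rewrite mxE ok enum_rankK.
have eq : nq = (m ^ 2)%N by rewrite /nq card_prod card_ord.
have ep : np = (m.+1 ^ 2)%N by rewrite /np card_prod card_ord.
by move: (\rank G) rk Gb => r; rewrite eq ep; lia.
Qed.
End MinorBound.

(** * From an intersection pattern to a minor *)

Lemma adj_in_sub (A A' : {set V}) x y : A \subset A' -> adj_in A x y -> adj_in A' x y.
Proof. by move=> /fintype.subsetP s /and3P[xA yA e]; rewrite /adj_in !s. Qed.

Lemma connect_in_sub (A A' : {set V}) x y : A \subset A' ->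
  connect (adj_in A) x y -> connect (adj_in A') x y.
Proof. by move=> s; apply: connect_sub => a b /(adj_in_sub s)/connect1. Qed.

Lemma connect_in_mem (A : {set V}) x y : x \in A -> connect (adj_in A) x y -> y \in A.
Proof.
move=> xA /connectP[p]; elim: p x xA => [|x' p IHp] x xA /=; first by move=> _ ->.
by move=> /andP[/and3P[_ x'A _]]; apply: IHp.
Qed.

(** A path inside [C] is cut just before its first vertex in [A]; this is the discrete form of
    following a curve until it meets another one. *)
Lemma first_hit (C A : {set V}) x y : x \in C -> x \notin A -> y \in A ->
  connect (adj_in C) x y ->
  exists y0 z, [/\ connect (adj_in (C :\: A)) x y0, z \in A & adj_in C y0 z].
Proof.
move=> xC xA yA /connectP[p]; elim: p x xC xA => [|x' p IHp] x xC xA /=.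
  by move=> _ e; rewrite -e yA in xA.
move=> /andP[xx' pth] l; have [x'A|x'A] := boolP (x' \in A).
  by exists x, x'; split.
have x'C : x' \in C by case/and3P: xx'.
have [y0 [z [c zA a]]] := IHp _ x'C x'A pth l.
exists y0, z; split=> //; apply: connect_trans (connect1 _) c.
by case/and3P: xx' => h1 h2 h3; rewrite /adj_in !inE xA x'A h1 h2.
Qed.

Section StringBound.
Variables (h : finType) (lam : h -> E -> 'F_2) (m : nat).
Local Notation I := 'I_m.+1.
Hypothesis D_le2 : forall e, (#|[set f | D f e != 0%R]| <= 2)%N.
Hypothesis D_cycle : forall f, is_cycle (D f).
Hypothesis boundaryP : forall z, is_cycle z -> (forall e, z e != 0 -> good e) ->
  (forall b, \sum_e lam b e * z e = 0) ->
  exists S : F -> 'F_2, forall e, z e = \sum_f S f * D f e.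
Variables (A : bool * I -> {set V}) (C : I * I -> {set V}).
Hypothesis A_conn : forall l, connected_in (A l).
Hypothesis C_conn : forall p, connected_in (C p).
Hypothesis A_disj : forall l l' x, x \in A l -> x \in A l' -> l = l'.
Hypothesis C_disj : forall p p' x, x \in C p -> x \in C p' -> p = p'.
Hypothesis AC_disj : forall l p x, x \in A l -> x \in C p ->
  l = (true, p.1) \/ l = (false, p.2).
Hypothesis AC_meet : forall p (b : bool),
  exists x, x \in A (b, if b then p.1 else p.2) /\ x \in C p.

Theorem string_graph_bound : (3 * m ^ 2 <= 3 * #|h| + 2 * m.+1 ^ 2)%N.
Proof.
(* The branch set of a left vertex u is A_u together with what can be reached
   from A_u inside each C_(u,v) before A_v is hit. *)
have /fin_all_exists[x0 x0P] p := AC_meet p true.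
have /fin_all_exists[y0 y0P] p := AC_meet p false.
pose C' p := C p :\: A (false, p.2).
have x0C' p : x0 p \in C' p.
  have [xA xC] := x0P p; rewrite inE xC andbT; apply/negP => /(A_disj xA).
  by case.
pose comp p := [set y | connect (adj_in (C' p)) (x0 p) y].
have compC' p : comp p \subset C' p.
  by apply/fintype.subsetP => y; rewrite inE; apply: connect_in_mem.
have hit p : exists yz, [/\ yz.1 \in comp p, yz.2 \in A (false, p.2) & adj_in (C p) yz.1 yz.2].
  have xC' := x0C' p; move: (xC'); rewrite inE => /andP[xnA xC].
  have [yA yC] := y0P p.
  have [y [z [c zA a]]] := first_hit xC xnA yA (C_conn xC yC).
  by exists (y, z); rewrite inE.
have [st stP] := fin_all_exists hit.
have /fin_all_exists[d dP] p : exists e, good e && joins e (st p).1 (st p).2.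
  by apply/existsP; have [_ _ /and3P[]] := stP p.
pose B (l : bool * I) := if l.1 then A l :|: \bigcup_v comp (l.2, v) else A l.
have BE l x : x \in B l -> x \in A l \/ exists2 v, l.1 & x \in comp (l.2, v).
  rewrite /B; case: l => [[] u] /=; last by left.
  by rewrite inE => /orP[|/finset.bigcupP[v _ xv]]; [left|right; exists v].
apply: (@bipartite_minor_bound h lam m B d (fun p => (st p).1) (fun p => (st p).2)) => //.
(* Among the sets [A l], a component can only meet that of its own left vertex: the other candidate
   was removed in [C' p]. *)
- have comp_A p x l : x \in comp p -> x \in A l -> l = (true, p.1).
    move=> /(fintype.subsetP (compC' p)); rewrite inE => /andP[xnA xC] xA.
    by case: (AC_disj xA xC) => // e; rewrite e (negPf xnA) in xA.
  move=> l l' x /BE[xA|[v lt xc]] /BE[xA'|[v' lt' xc']].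
  + exact: A_disj xA xA'.
  + by rewrite (comp_A _ _ _ xc' xA) /= -lt'; case: (l').
  + by rewrite (comp_A _ _ _ xc xA') /= -lt; case: (l).
  + move: (fintype.subsetP (compC' _) _ xc) (fintype.subsetP (compC' _) _ xc').
    rewrite !inE => /andP[_ c] /andP[_ c'].
    case: (C_disj c c'); move: lt lt' => {xc xc' c c'}.
    by case: l l' => [[] u] [[] u'] //= _ _ ->.
- move=> [[] u]; last exact: A_conn.
  rewrite /B /=.
  set BB := _ :|: _.
  have AB : A (true, u) \subset BB by apply: finset.subsetUl.
  (* Every vertex of the branch set is reached from [A (true, u)], since each component is grown
     from the vertex [x0 (u, v)] of that set. *)
  have hub x : x \in BB -> exists2 a, a \in A (true, u) & connect (adj_in BB) a x.
    rewrite inE => /orP[xA|/finset.bigcupP[v _ xv]]; first by exists x.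
    exists (x0 (u, v)); first by have [] := x0P (u, v).
    have c : connect (adj_in (C' (u, v))) (x0 (u, v)) x by rewrite inE in xv.
    move: c => /connectP[p]; elim/last_ind: p x xv => [|p x' IHp] x xv /=.
      by move=> _ ->.
    rewrite rcons_path last_rcons => /andP[pth ad] ->.
    set y := last _ p in ad.
    have cy : connect (adj_in (C' (u, v))) (x0 (u, v)) y by apply/connectP; exists p.
    have yc : y \in comp (u, v) by rewrite inE.
    apply: connect_trans (IHp y yc pth erefl) (connect1 _).
    have inBB w : w \in comp (u, v) -> w \in BB.
      by move=> wc; rewrite inE; apply/orP; right; apply/finset.bigcupP; exists v.
    have xc : x' \in comp (u, v) by rewrite inE (connect_trans cy (connect1 ad)).
    by case/and3P: ad => _ _ ad; rewrite /adj_in !inBB.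
  move=> x y /hub[a aA ca] /hub[b bA cb].
  apply: connect_trans (connect_trans (connect_in_sub AB (A_conn aA bA)) cb).
  by rewrite connect_in_sym.
- by move=> p; have /andP[] := dP p.
- by move=> p; have /andP[] := dP p.
- move=> [u v]; rewrite /B /= inE; apply/orP; right; apply/finset.bigcupP; exists v => //.
  by have [] := stP (u, v).
- by move=> p; have [] := stP p.
Qed.
End StringBound.

End Complex.

(** * Strip complexes *)

(* S and U are the vertices and edges of a multigraph (the slice). The complex has
   a vertex (i, k) for each column i <= L and k in S, horizontal edges inl (i, k)
   from column i to i+1, vertical edges inr (i, t), and a square (i, t) between
   the columns i and i+1 over the slice edge t when lo t <= i < hi t. A vertical
   edge not touching such a square is excluded by strip_good. *)
Section Strip.
Variables (L : nat) (S U0 U1 : finType).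
Local Notation U := (U0 + U1)%type.
Variables (p q : U -> S) (lo hi : U -> nat).
Local Notation V := ('I_L.+1 * S)%type.
Local Notation E := ('I_L * S + 'I_L.+1 * U)%type.
Local Notation F := ('I_L * U)%type.

Let wd (i : 'I_L) : 'I_L.+1 := widen_ord (leqnSn L) i.
Let nx (i : 'I_L) : 'I_L.+1 := lift ord0 i.

Definition strip_src (e : E) : V :=
  match e with inl (i, k) => (widen_ord (leqnSn L) i, k) | inr (i, t) => (i, p t) end.
Definition strip_tgt (e : E) : V :=
  match e with inl (i, k) => (lift ord0 i, k) | inr (i, t) => (i, q t) end.
Definition strip_inc (f : F) (e : E) : 'F_2 :=
  let: (i, t) := f in
  if (lo t <= i < hi t)%N then
    (e == inl (i, p t))%:R + (e == inl (i, q t))%:R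
    + (e == inr (widen_ord (leqnSn L) i, t))%:R + (e == inr (lift ord0 i, t))%:R
  else 0.
Definition strip_good (e : E) : bool :=
  match e with inl _ => true | inr (i, t) => (lo t <= i <= hi t)%N end.
(** Counts mod 2 the edges lying over the slice edge [b]. The edges in [U0] are meant to form a
    forest, so that only [U1] can carry an obstruction to being a boundary. *)
Definition strip_lam (b : U1) (e : E) : 'F_2 :=
  match e with inl _ => 0 | inr (i, t) => (t == inr b)%:R end.

Local Notation src := strip_src.
Local Notation tgt := strip_tgt.
Local Notation D := strip_inc.
Local Notation good := strip_good.
Local Notation lam := strip_lam.
Local Notation cob := (coboundary src tgt).

Let sum_delta (T : finType) (a : T -> 'F_2) x : \sum_e (e == x)%:R * a e = a x.
Proof.
rewrite (bigD1 x) //= eqxx mul1r big1 ?addr0 // => e /negPf ->.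
by rewrite mul0r.
Qed.

Let D_pair (al : E -> 'F_2) i t : \sum_e D (i, t) e * al e =
  if (lo t <= i < hi t)%N then al (inl (i, p t)) + al (inl (i, q t))
    + al (inr (wd i, t)) + al (inr (nx i, t)) else 0.
Proof.
rewrite /D; case: ifP => _; last by rewrite big1 // => e _; rewrite mul0r.
under eq_bigr do rewrite !mulrDl.
by rewrite !big_split /= !sum_delta.
Qed.

Lemma strip_inc_cycle f : is_cycle src tgt (D f).
Proof.
case: f => i t phi; rewrite D_pair; case: ifP => // _; rewrite /coboundary /=.
set a := phi _; set b := phi _; set c := phi _; set d := phi _.
rewrite -[RHS](F2_addxx (a + b + c + d)); ring.
Qed.

(** The squares on a horizontal edge correspond to the active slice edges at its slice vertex,
    whence the degree hypothesis; those on a vertical edge are the one to its left and the one to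
    its right. *)
Lemma strip_inc_le2 :
  (forall (i : 'I_L) k,
    (#|[set t | (lo t <= i < hi t)%N && ((p t == k) || (q t == k))]| <= 2)%N) ->
  forall e, (#|[set f | D f e != 0%R]| <= 2)%N.
Proof.
move=> deg [[i k]|[i t]].
  apply: leq_trans (deg i k).
  apply: leq_trans (leq_imset_card (fun t => (i, t)) _).
  apply/subset_leq_card/fintype.subsetP => -[i' t]; rewrite inE /D.
  case: ifP => [act|_]; last by rewrite eqxx.
  rewrite !(inj_eq inl_inj) !xpair_eqE !addr0 => nz.
  have ei : i = i' by apply/eqP; apply: contraNT nz => /negPf ->.
  subst i'; apply/imsetP; exists t => //; rewrite inE act /=.
  rewrite eqxx /= !(eq_sym k) in nz.
  by apply: contraNT nz; rewrite negb_or => /andP[/negPf-> /negPf->].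
apply: (@leq_trans #|{: bool}|); last by rewrite card_bool.
have key i' t' : D (i', t') (inr (i, t)) != 0 -> t' = t /\ ((i = i' :> nat) \/ (i = i'.+1 :> nat)).
  rewrite /D; case: ifP => [act|_]; last by rewrite eqxx.
  rewrite !(inj_eq inr_inj) !xpair_eqE /= !add0r => nz.
  have et : t = t' by apply/eqP; apply: contraNT nz => /negPf ->; rewrite !andbF.
  split=> //; have [->|n1] := eqVneq i (wd i'); [by left|right].
  have [->|n2] := eqVneq i (nx i'); first by [].
  by move: nz; rewrite (negPf n1) (negPf n2).
rewrite -(card_in_imset (f := fun f : F => (i == f.1 :> nat))) ?max_card //.
move=> [i1 t1] [i2 t2]; rewrite !inE => /key[-> h1] /key[-> h2] /= e.
by congr (_, _); apply/val_inj; move: h1 h2 e => /=; lia.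
Qed.

(** Linear duality: [z] is a combination of squares once it is killed by every cochain that kills
    all squares. On good edges such a cochain is a coboundary plus a combination of the [lam b]. *)
Lemma strip_boundary (z : E -> 'F_2) :
  (forall ep : U0 -> 'F_2, exists chi : S -> 'F_2,
     forall t, chi (p (inl t)) + chi (q (inl t)) = ep t) ->
  is_cycle src tgt z -> (forall e, z e != 0 -> good e) ->
  (forall b, \sum_e lam b e * z e = 0) ->
  exists s : F -> 'F_2, forall e, z e = \sum_f s f * D f e.
Proof.
move=> forest zcyc zgood zlam.
have orth (al : E -> 'F_2) : (forall f, \sum_e D f e * al e = 0) -> \sum_e z e * al e = 0.
  move=> closed.
  (* psi kills the cocycle on horizontal edges; closedness then makes it constant
     along each slice edge, and chi kills it on U0. *)
  pose psi (v : V) := \sum_(j < L | (j < v.1)%N) al (inl (j, v.2)).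
  have psiS (j : 'I_L) k : psi (nx j, k) = psi (wd j, k) + al (inl (j, k)).
    rewrite /psi /= (bigD1 j) ?leqnn //= addrC; congr (_ + _).
    by apply: eq_bigl => j'; rewrite /bump /= add1n ltnS ltn_neqAle andbC.
  pose be i t := al (inr (i, t)) + cob psi (inr (i, t)).
  have beS (i : 'I_L) t : (lo t <= i < hi t)%N -> be (nx i) t = be (wd i) t.
    move=> act; have := closed (i, t); rewrite D_pair act => c.
    apply: F2_addr_eq0; rewrite /be /coboundary /= !psiS -[RHS]c.
    set a := al _; set b := al (inr (wd _, _)); set x := psi _; set y := psi _.
    rewrite -[RHS]addr0 -(F2_addxx (x + y)); ring.
  pose ep t := be (inord (lo t)) t.
  have beE (i : 'I_L.+1) t : (lo t <= i <= hi t)%N -> be i t = ep t.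
    move: {2}(nat_of_ord i) (erefl (nat_of_ord i)) => n; elim: n i => [|n IHn] i ei.
      move=> /andP[h _]; congr (be _ t); apply/val_inj => /=; rewrite inordK //; lia.
    move=> /andP[]; rewrite leq_eqVlt => /orP[/eqP e _|h1 h2].
      by rewrite /ep e inord_val.
    have nL : (n < L)%N by have := ltn_ord i; lia.
    have -> : i = nx (Ordinal nL) by apply/val_inj; rewrite /= /bump ei.
    rewrite beS /=; last lia.
    by apply: IHn => //=; lia.
  have [chi chiE] := forest (ep \o inl).
  pose phi v := psi v + chi v.2.
  pose de t := ep t + chi (p t) + chi (q t).
  transitivity (\sum_e z e * cob phi e + \sum_b de (inr b) * \sum_e lam b e * z e).
    under [X in _ = _ + X]eq_bigr do rewrite mulr_sumr.
    rewrite exchange_big -big_split /=; apply: eq_bigr => e _.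
    have [->|/zgood ge] := eqVneq (z e) 0.
      by rewrite !mul0r big1 ?addr0 // => b _; rewrite !mulr0.
    case: e ge => [[i k] _|[i t] ge].
      rewrite [X in _ = _ + X]big1 => [|b _]; last by rewrite mul0r mulr0.
      rewrite addr0 /coboundary /phi /= psiS; congr (_ * _).
      set x := psi _; set c := chi _; rewrite -[LHS]add0r -(F2_addxx (x + c)); ring.
    have -> : \sum_b de (inr b) * (lam b (inr (i, t)) * z (inr (i, t))) = z (inr (i, t)) * de t.
      case: t ge => [t|b] ge.
        rewrite big1 => [|b _]; last by rewrite /= mul0r mulr0.
        by rewrite /de -addrA chiE F2_addxx mulr0.
      rewrite (bigD1 b) //= eqxx mul1r mulrC big1 ?addr0 // => b' nb.
      by rewrite (inj_eq inr_inj) eq_sym (negPf nb) mul0r mulr0.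
    rewrite -mulrDr; congr (_ * _); rewrite /de -(beE _ _ ge) /be /coboundary /phi /=.
    set x := psi _; set y := psi _; set u := chi _; set v := chi _.
    rewrite -[LHS]add0r -(F2_addxx (x + y + u + v)); ring.
  by rewrite zcyc add0r big1 // => b _; rewrite zlam mulr0.
pose M : 'M['F_2]_(#|{: F}|, #|{: E}|) := \matrix_(i, j) D (enum_val i) (enum_val j).
pose zr : 'rV['F_2]_(#|{: E}|) := \row_j z (enum_val j).
have /submxP[s sE] : (zr <= M)%MS.
  rewrite submxE; apply/eqP/rowP => k; rewrite [RHS]mxE.
  pose al e := cokermx M (enum_rank e) k.
  rewrite mxE (reindex enum_rank) /=; last by apply: onW_bij; apply: enum_rank_bij.
  under eq_bigr do rewrite mxE enum_rankK.
  apply: (orth al) => f.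
  have /matrixP/(_ (enum_rank f) k) := mulmx_coker M.
  rewrite mxE (reindex enum_rank) /=; last by apply: onW_bij; apply: enum_rank_bij.
  under eq_bigr do rewrite mxE !enum_rankK.
  by rewrite mxE.
exists (fun f => s 0 (enum_rank f)) => e.
have /rowP/(_ (enum_rank e)) := sE; rewrite mxE enum_rankK => ->.
rewrite mxE (reindex enum_rank) /=; last by apply: onW_bij; apply: enum_rank_bij.
by apply: eq_bigr => f _; rewrite mxE !enum_rankK.
Qed.

End Strip.

(* The slice consists of two paths a = true, false with K edges each and of rungs
   (r, w), present over the columns between cut r and cut r.+1: for r even they join
   the w-ends of the two paths, for r odd the two ends of path w. The complex is
   thus two rectangles with 2(2g+1) bands attached. *)
Section BandSurface.
Variables (L K g : nat) (cut : nat -> nat).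
Local Notation S := (bool * 'I_K.+1)%type.
Local Notation U0 := (bool * 'I_K)%type.
Local Notation U1 := ('I_g.*2.+1 * bool)%type.
Local Notation V := ('I_L.+1 * S)%type.

Definition row_end (w : bool) : 'I_K.+1 := if w then ord_max else ord0.

Definition band_p (t : U0 + U1) : S :=
  match t with
  | inl (a, k) => (a, widen_ord (leqnSn K) k)
  | inr (r, w) => if odd r then (w, ord0) else (true, row_end w)
  end.
Definition band_q (t : U0 + U1) : S :=
  match t with
  | inl (a, k) => (a, lift ord0 k)
  | inr (r, w) => if odd r then (w, ord_max) else (false, row_end w)
  end.
Definition band_lo (t : U0 + U1) : nat := if t is inr (r, _) then cut r else 0%N.
Definition band_hi (t : U0 + U1) : nat := if t is inr (r, _) then cut r.+1 else L.

Definition band_adj : {set V} -> rel V :=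
  adj_in (strip_src band_p) (strip_tgt band_q) (strip_good band_lo band_hi).

Definition band_connected (A : {set V}) : Prop :=
  forall x y, x \in A -> y \in A -> connect (band_adj A) x y.

Section Adjacency.
Variable A : {set V}.

Lemma band_conn_sym : connect_sym (band_adj A).
Proof. exact: connect_in_sym. Qed.

Lemma band_conn_col (i i' : 'I_L.+1) s : (i <= i'.+1)%N -> (i' <= i.+1)%N ->
  (i, s) \in A -> (i', s) \in A -> connect (band_adj A) (i, s) (i', s).
Proof.
wlog : i i' / (i <= i')%N => [H|le _ h xA yA].
  by case: (leqP i i') => [|/ltnW] h h1 h2 h3 h4; [|rewrite band_conn_sym]; apply: H.
move: le; rewrite leq_eqVlt => /orP[/eqP/val_inj -> //|lt].
have iL : (i < L)%N by have := ltn_ord i'; lia.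
apply: connect1; rewrite /band_adj /adj_in xA yA; apply/existsP.
exists (inl (Ordinal iL, s)); rewrite /= /joins /= !xpair_eqE eqxx !andbT.
by rewrite -!val_eqE /= /bump /= add1n eqxx /= eqn_leq lt h.
Qed.

Lemma band_conn_row i a (k k' : 'I_K.+1) : (k <= k'.+1)%N -> (k' <= k.+1)%N ->
  (i, (a, k)) \in A -> (i, (a, k')) \in A ->
  connect (band_adj A) (i, (a, k)) (i, (a, k')).
Proof.
wlog : k k' / (k <= k')%N => [H|le _ h xA yA].
  by case: (leqP k k') => [|/ltnW] h h1 h2 h3 h4; [|rewrite band_conn_sym]; apply: H.
move: le; rewrite leq_eqVlt => /orP[/eqP/val_inj -> //|lt].
have kK : (k < K)%N by have := ltn_ord k'; lia.
apply: connect1; rewrite /band_adj /adj_in xA yA; apply/existsP.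
exists (inr (i, inl (a, Ordinal kK))); rewrite /= /joins /= !xpair_eqE !eqxx /=.
rewrite -!val_eqE /= /bump /= add1n eqxx /= eqn_leq lt h /=.
by rewrite -ltnS ltn_ord.
Qed.

Lemma band_conn_gap (r : 'I_g.*2.+1) (i : 'I_L.+1) w a a' :
  ~~ odd r -> (cut r <= i <= cut r.+1)%N ->
  (i, (a, row_end w)) \in A -> (i, (a', row_end w)) \in A ->
  connect (band_adj A) (i, (a, row_end w)) (i, (a', row_end w)).
Proof.
move=> ev ri; wlog : a a' / a => [H xA yA|].
  case: a a' xA yA => [] [] xA yA; try exact: H; try exact: connect0.
  by rewrite band_conn_sym; apply: H.
case: a => // _; case: a' => // xA yA.
apply: connect1; rewrite /band_adj /adj_in xA yA; apply/existsP.
by exists (inr (i, inr (r, w))); rewrite /= ri /joins /= (negPf ev) !eqxx.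
Qed.

Lemma band_conn_hole (r : 'I_g.*2.+1) (i : 'I_L.+1) w w' a :
  odd r -> (cut r <= i <= cut r.+1)%N ->
  (i, (a, row_end w)) \in A -> (i, (a, row_end w')) \in A ->
  connect (band_adj A) (i, (a, row_end w)) (i, (a, row_end w')).
Proof.
move=> od ri; wlog : w w' / ~~ w => [H xA yA|].
  case: w w' xA yA => [] [] xA yA; try exact: H; try exact: connect0.
  by rewrite band_conn_sym; apply: H.
case: w => // _; case: w' => // xA yA.
apply: connect1; rewrite /band_adj /adj_in xA yA; apply/existsP.
by exists (inr (i, inr (r, a))); rewrite /= ri /joins /= od !eqxx.
Qed.

End Adjacency.
Hypothesis K_gt0 : (0 < K)%N.
Hypothesis cut_mono : {homo cut : r r' / (r <= r')%N}.

(** The edges in [U0] form two disjoint paths, so partial sums along each path give a potential. *)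
Lemma band_forest (ep : U0 -> 'F_2) : exists chi : S -> 'F_2,
  forall t, chi (band_p (inl t)) + chi (band_q (inl t)) = ep t.
Proof.
exists (fun s : S => \sum_(k < K | (k < s.2)%N) ep (s.1, k)) => -[a k] /=.
rewrite addrC (bigD1 k) ?leqnn //= -[RHS]addr0 -addrA; congr (_ + _).
rewrite [X in X + _](_ : _ = \sum_(k' < K | (k' < k)%N) ep (a, k')) ?F2_addxx //.
by apply: eq_bigl => k'; rewrite /bump /= add1n ltnS ltn_neqAle andbC.
Qed.

(** The slice imitates a section of the surface by a plane x = const: the rungs close the two paths
    into one circle over an even run and into two circles over an odd run. *)
Lemma band_degree (i : 'I_L) k :
  (#|[set t | (band_lo t <= i < band_hi t)%N && ((band_p t == k) || (band_q t == k))]| <= 2)%N.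
Proof.
case: k => a k; apply: (@leq_trans #|{: bool}|); last by rewrite card_bool.
(* At an inner vertex [key] separates the two path edges, at an end vertex the path edge from the
   rung. Two rungs cannot be active at the same vertex, as distinct runs share no column
   interval. *)
pose key (t : U0 + U1) : bool :=
  match t with inl (_, k') => (k' == k :> nat) | inr _ => (k != 0%N :> nat) end.
rewrite -(card_in_imset (f := key)) ?max_card //.
have rungE (r : 'I_g.*2.+1) w :
    (band_p (inr (r, w)) == (a, k)) || (band_q (inr (r, w)) == (a, k)) ->
    (if odd r then w = a else w = (k != 0%N :> nat)) /\ (k = 0%N :> nat \/ k = K :> nat).
  rewrite /=; case: odd; rewrite !xpair_eqE.
    by move=> /orP[] /andP[/eqP-> /eqP<-]; split=> //; [left|right].
  by move=> /orP[] /andP[_ /eqP<-]; rewrite /row_end; case: w; split=> //=;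
    try (by left); try (by right); lia.
have pathE a' (k' : 'I_K) :
    (band_p (inl (a', k')) == (a, k)) || (band_q (inl (a', k')) == (a, k)) ->
    a' = a /\ (k = k' :> nat \/ k = k'.+1 :> nat).
  by rewrite /= !xpair_eqE => /orP[] /andP[/eqP-> /eqP<-]; split=> //; [left|right].
have := ltn_ord k.
move=> kK [[a1 k1]|[r1 w1]] [[a2 k2]|[r2 w2]]; rewrite !inE => /andP[act1 h1] /andP[act2 h2] /=.
- move: h1 h2 => /pathE[-> c1] /pathE[-> c2] e; congr (inl (_, _)); apply/val_inj => /=; lia.
- move: h1 h2 => /pathE[-> c1] /rungE[_ c2] e; have := ltn_ord k1; lia.
- move: h1 h2 => /rungE[_ c1] /pathE[-> c2] e; have := ltn_ord k2; lia.
- move=> _; have er : r1 = r2.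
    apply/val_inj => /=; move: act1 act2 => /=.
    have [h|h|//] := ltngtP r1 r2; have := cut_mono h; lia.
  subst r2; move: h1 h2 => /rungE[e1 _] /rungE[e2 _].
  by move: e1 e2; case: odd => -> ->.
Qed.

Theorem band_string_bound (m : nat) (A : bool * 'I_m.+1 -> {set V})
    (C : 'I_m.+1 * 'I_m.+1 -> {set V}) :
  (forall l, band_connected (A l)) -> (forall p, band_connected (C p)) ->
  (forall l l' x, x \in A l -> x \in A l' -> l = l') ->
  (forall p p' x, x \in C p -> x \in C p' -> p = p') ->
  (forall l p x, x \in A l -> x \in C p -> l = (true, p.1) \/ l = (false, p.2)) ->
  (forall p (b : bool), exists x, x \in A (b, if b then p.1 else p.2) /\ x \in C p) ->
  (3 * m ^ 2 <= 12 * g + 6 + 2 * m.+1 ^ 2)%N.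
Proof.
move=> Ac Cc Ad Cd ACd ACm.
have -> : (12 * g + 6 = 3 * #|{: U1}|)%N by rewrite card_prod card_ord card_bool; lia.
refine (@string_graph_bound _ _ _ (strip_src band_p) (strip_tgt band_q)
  (strip_inc band_p band_q band_lo band_hi) (strip_good band_lo band_hi)
  U1 (@strip_lam L S U0 U1) m _ _ _ A C Ac Cc Ad Cd ACd ACm).
- exact: strip_inc_le2 band_degree.
- exact: strip_inc_cycle.
- by move=> z; apply: strip_boundary band_forest.
Qed.

End BandSurface.

(** * Parametrisation of the surface *)

Local Open Scope classical_set_scope.
Local Open Scope ring_scope.

Section Param.
Variables (R : realType) (g b : nat).
Local Notation pt := (R * R * R)%type.
Local Notation Rr := (Rg R g b).

(** As [Num.sqrt] is 0 on negative reals, the arc is 0 off the hole; the maximum of these arcs is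
    thus the lower border of the half domain y >= 0, made of pieces of the x-axis and upper half
    circles of holes. *)
Definition hole_arc (i : nat) (x : R) : R := Num.sqrt (1 - (x - (4 * i)%:R) ^+ 2).

Fixpoint lower_arc (n : nat) (x : R) : R :=
  if n is n'.+1 then Num.max (lower_arc n' x) (hole_arc n x) else 0.

Definition upper_arc (x : R) : R := Num.sqrt (Rr ^+ 2 - x ^+ 2).

Local Notation lw := (lower_arc g).
Local Notation up := upper_arc.

(* For |x| <= Rg and |w| <= 1, param a (x, w) runs over the half +-y >= 0 of the
   surface: |y| goes from the lower arc at w = 1 up to the outer circle at w = 0 and
   back to the lower arc at w = -1 on the other sheet. There -q = |w| * depth, and
   sqrt w - sqrt (- w) is the odd square root, Num.sqrt being 0 on negative reals. *)
Definition height (u : R * R) : R := lw u.1 + (1 - `|u.2|) * (up u.1 - lw u.1).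

Definition depth (u : R * R) : R := (up u.1 - lw u.1) * (up u.1 + height u) *
  \prod_(1 <= i < g.+1) ((u.1 - (4 * i)%:R) ^+ 2 + height u ^+ 2 - 1).

Definition param (a : bool) (u : R * R) : pt :=
  (u.1, (if a then height u else - height u),
   (Num.sqrt u.2 - Num.sqrt (- u.2)) * Num.sqrt (depth u)).

Definition in_rect (u : R * R) : Prop := `|u.1| <= Rr /\ `|u.2| <= 1.

Lemma sqr_le1_bounds (s : R) : s ^+ 2 <= 1 -> -1 <= s <= 1.
Proof.
move=> h; rewrite -ler_norml -(ler_pXn2r (ltn0Sn 1)) ?nnegrE //.
by rewrite expr1n real_normK ?num_real.
Qed.

Lemma lower_arc_ge0 n x : 0 <= lower_arc n x.
Proof. by elim: n => //= n IHn; rewrite le_max IHn. Qed.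

Lemma hole_le_lower n i x : (1 <= i <= n)%N -> hole_arc i x <= lower_arc n x.
Proof.
elim: n => [|n IHn]; first by case: i.
move=> /andP[i1]; rewrite leq_eqVlt => /orP[/eqP->|]; first by rewrite /= le_max lexx orbT.
by rewrite ltnS => h; rewrite /= le_max IHn ?i1.
Qed.

Lemma lower_arcP n x : lower_arc n x = 0 \/
  exists i, [/\ (1 <= i <= n)%N, lower_arc n x = hole_arc i x & (x - (4 * i)%:R) ^+ 2 < 1].
Proof.
elim: n => [|n IHn] /=; first by left.
have [lt|le] := leP (lower_arc n x) (hole_arc n.+1 x); last first.
  case: IHn => [->|[i [i1 e h]]]; [by left|right]; exists i; split=> //.
  by case/andP: i1 => -> /leqW.
have [z|nz] := eqVneq (hole_arc n.+1 x) 0; [by left|right].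
exists n.+1; rewrite leqnn; split=> //.
have : 0 < hole_arc n.+1 x by rewrite lt_def nz sqrtr_ge0.
by rewrite sqrtr_gt0 subr_gt0.
Qed.

Lemma Rg_ge (i : nat) : (i <= g)%N -> (4 * i)%:R + 10 <= Rr.
Proof. by move=> h; rewrite /Rg -[10]/(10%:R) -natrD ler_nat; lia. Qed.

Lemma upper_sqr x : `|x| <= Rr -> up x ^+ 2 = Rr ^+ 2 - x ^+ 2.
Proof.
move=> h; rewrite sqr_sqrtr // subr_ge0 -(real_normK (num_real x)).
by rewrite lerXn2r // nnegrE ?normr_ge0 // /Rg ler0n.
Qed.

(** The margin 10 in [Rg] keeps the outer circle above height 1 over each hole. *)
Lemma hole_lt_upper i x : (i <= g)%N -> (x - (4 * i)%:R) ^+ 2 <= 1 ->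
  1 < Rr ^+ 2 - x ^+ 2.
Proof.
move=> /Rg_ge h1 h2; have i0 : 0 <= (4 * i)%:R :> R by apply: ler0n.
move: (4 * i)%:R Rr h1 h2 i0 => c r h1 h2 i0.
have /andP[xb xa] := sqr_le1_bounds h2.
nra.
Qed.

Lemma lower_lt_upper x : `|x| < Rr -> lw x < up x.
Proof.
move=> h; have [->|[i [/andP[_ i1] -> c]]] := lower_arcP g x.
  rewrite sqrtr_gt0 subr_gt0 -(real_normK (num_real x)).
  by rewrite ltrXn2r // ?nnegrE // (le_trans _ (ltW h)).
have := hole_lt_upper i1 (ltW c) => h1.
rewrite /hole_arc /up ltr_sqrt; last by lra.
by have := sqr_ge0 (x - (4 * i)%:R); lra.
Qed.

Lemma arcs_end x : `|x| = Rr -> lw x = 0 /\ up x = 0.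
Proof.
move=> h; have h2 : Rr ^+ 2 - x ^+ 2 = 0 by rewrite -h real_normK ?num_real // subrr.
split; last by rewrite /up h2 sqrtr0.
have [->//|[i [/andP[_ i1] _ c]]] := lower_arcP g x.
have := hole_lt_upper i1 (ltW c); lra.
Qed.

Lemma lower_le_upper x : `|x| <= Rr -> lw x <= up x.
Proof.
rewrite le_eqVlt => /orP[/eqP/arcs_end[-> ->]//|/lower_lt_upper/ltW//].
Qed.

(** Each of the g factors changes sign, which absorbs the factor (-1)^g. *)
Lemma qfunE x y : qfun g b x y =
  (x ^+ 2 + y ^+ 2 - Rr ^+ 2) * \prod_(1 <= i < g.+1) ((x - (4 * i)%:R) ^+ 2 + y ^+ 2 - 1).
Proof.
rewrite /qfun; set c := (_ - Rr ^+ 2); rewrite (mulrC _ c) -mulrA; congr (_ * _).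
elim: (g) => [|n IHn]; first by rewrite !big_geq // mulr1.
by rewrite !(big_nat_recr n.+1) //= -IHn exprS; ring.
Qed.

(** The holes are pairwise disjoint and lie inside the outer circle. Hence exactly two factors of
    [qfun] are negative inside a hole, and none outside the outer circle; in both cases the product
    is positive. *)
Lemma qfun_le0 x y : qfun g b x y <= 0 ->
  x ^+ 2 + y ^+ 2 <= Rr ^+ 2 /\
  forall i, (1 <= i <= g)%N -> 1 <= (x - (4 * i)%:R) ^+ 2 + y ^+ 2.
Proof.
rewrite qfunE => q0.
have inD i : (1 <= i <= g)%N -> (x - (4 * i)%:R) ^+ 2 + y ^+ 2 <= 1 ->
    x ^+ 2 + y ^+ 2 < Rr ^+ 2.
  move=> /andP[_ ig] h; have i0 : 0 <= (4 * i)%:R :> R by apply: ler0n.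
  have := Rg_ge ig; move: (4 * i)%:R Rr h i0 => c r h i0 h1.
  have [y0 c0] := (sqr_ge0 y, sqr_ge0 (x - c)).
  have /andP[xb xa] : -1 <= x - c <= 1 by apply: sqr_le1_bounds; lra.
  nra.
have sep i j : (i < j)%N -> (x - (4 * i)%:R) ^+ 2 + y ^+ 2 < 1 ->
    1 < (x - (4 * j)%:R) ^+ 2 + y ^+ 2.
  move=> ij; have : (4 * i)%:R + 4 <= (4 * j)%:R :> R.
    by rewrite -[4 in leLHS]/(4%:R) -natrD ler_nat; lia.
  move: (4 * i)%:R (4 * j)%:R => c d h h1.
  have y0 := sqr_ge0 y.
  have /andP[xb xa] : -1 <= x - c <= 1 by apply: sqr_le1_bounds; lra.
  nra.
have sep' i j : (i < j)%N -> (x - (4 * j)%:R) ^+ 2 + y ^+ 2 < 1 ->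
    1 < (x - (4 * i)%:R) ^+ 2 + y ^+ 2.
  move=> ij; have : (4 * i)%:R + 4 <= (4 * j)%:R :> R.
    by rewrite -[4 in leLHS]/(4%:R) -natrD ler_nat; lia.
  move: (4 * i)%:R (4 * j)%:R => c d h h1.
  have y0 := sqr_ge0 y.
  have /andP[xb xa] : -1 <= x - d <= 1 by apply: sqr_le1_bounds; lra.
  nra.
have out i : (1 <= i <= g)%N -> 1 <= (x - (4 * i)%:R) ^+ 2 + y ^+ 2.
  move=> ig; rewrite leNgt; apply/negP => lt.
  move: q0; rewrite leNgt => /negP[].
  rewrite (bigD1_seq i) ?iota_uniq ?mem_index_iota ?ltnS //= mulrA.
  rewrite pmulr_rgt0; last first.
    by have := inD i ig (ltW lt); nra.
  rewrite big_seq_cond prodr_gt0 // => j /andP[_ nij].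
  rewrite subr_gt0; have [/sep'|/sep|e] := ltngtP j i; try exact.
  by rewrite e eqxx in nij.
split=> //; rewrite leNgt; apply/negP => lt.
move: q0; rewrite leNgt => /negP[].
rewrite pmulr_rgt0 ?subr_gt0 // big_seq prodr_gt0 // => i; rewrite mem_index_iota ltnS => ig.
rewrite subr_gt0 lt_neqAle out // andbT eq_sym; apply/eqP => e.
by have := inD i ig; rewrite e lexx => /(_ isT); lra.
Qed.

Lemma height_bounds u : in_rect u -> lw u.1 <= height u <= up u.1.
Proof.
move=> [h1 h2]; have := lower_le_upper h1; have := normr_ge0 u.2; rewrite /height.
move: (lw _) (up _) `|u.2| h2 => m M w h2 h3 h4; apply/andP; split; nra.
Qed.

Lemma height_ge0 u : in_rect u -> 0 <= height u.
Proof. by move=> /height_bounds/andP[h _]; apply: le_trans h; apply: lower_arc_ge0. Qed.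

Lemma param_surj (p : pt) : closed_surface g b p ->
  exists a u, in_rect u /\ param a u = p.
Proof.
case: p => -[x y] z; rewrite /closed_surface /= => e.
have z0 := sqr_ge0 z.
have [xy ho] : x ^+ 2 + y ^+ 2 <= Rr ^+ 2 /\
  forall i, (1 <= i <= g)%N -> 1 <= (x - (4 * i)%:R) ^+ 2 + y ^+ 2.
  by apply: qfun_le0; lra.
have R0 : 0 <= Rr by rewrite /Rg ler0n.
have xR : `|x| <= Rr.
  by rewrite -(ler_pXn2r (ltn0Sn 1)) ?nnegrE // real_normK ?num_real //; have := sqr_ge0 y; lra.
(* At x = Rg or x = -Rg the section shrinks to a point, and the quotient [w] used otherwise would
   have denominator 0. *)
have [xe|xe] := eqVneq `|x| Rr.
  have [m0 M0] := arcs_end xe.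
  have x2 : x ^+ 2 = Rr ^+ 2 by rewrite -xe real_normK ?num_real.
  have y0 : y = 0 by apply/eqP; rewrite -sqrf_eq0; apply/eqP; have := sqr_ge0 y; lra.
  have z00 : z = 0.
    apply/eqP; rewrite -sqrf_eq0; apply/eqP; move: e; rewrite qfunE x2 y0.
    by rewrite expr0n /= addr0 subrr mul0r addr0.
  exists true, (x, 0); split; first by split; rewrite //= ?normr0.
  by rewrite /param /height /= m0 M0 !(oppr0, subrr, addr0, mul0r, mulr0) y0 z00.
have lt : lw x < up x by apply: lower_lt_upper; rewrite lt_neqAle xe.
have yM : `|y| <= up x.
  rewrite -(ler_pXn2r (ltn0Sn 1)) ?nnegrE ?sqrtr_ge0 // upper_sqr // real_normK ?num_real //.
  by lra.
have ym : lw x <= `|y|.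
  have [->//|[i [ig -> _]]] := lower_arcP g x.
  rewrite -(ler_pXn2r (ltn0Sn 1)) ?nnegrE ?sqrtr_ge0 // real_normK ?num_real //.
  have := ho i ig => hi; rewrite /hole_arc.
  have [s0|s0] := leP 0 (1 - (x - (4 * i)%:R) ^+ 2).
    by rewrite sqr_sqrtr //; lra.
    by rewrite ler0_sqrtr; [have := sqr_ge0 y; lra|exact: ltW].
set d := up x - lw x; have d0 : 0 < d by rewrite subr_gt0.
(* Solves [height (x, w) = |y|]; the sign given to it in [w'] then selects the sheet. *)
pose w := (up x - `|y|) / d.
have w0 : 0 <= w by apply: divr_ge0; [rewrite subr_ge0|exact: ltW].
have w1 : w <= 1 by rewrite ler_pdivrMr // mul1r /d lerD2l lerN2.
have wd : w * d = up x - `|y| by rewrite /w divfK // gt_eqF.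
pose w' := if 0 <= z then w else - w.
have nw' : `|w'| = w by rewrite /w'; case: ifP => _; rewrite ?normrN ger0_norm.
have hy : height (x, w') = `|y|.
  by rewrite /height /= nw' -/d mulrBl mul1r wd /d; ring.
exists (0 <= y), (x, w'); split; first by split; rewrite //= nw'.
have zz : w * depth (x, w') = z ^+ 2.
  have -> : z ^+ 2 = - qfun g b x y by lra.
  rewrite qfunE /depth /= hy -/d !mulrA wd.
  under [X in _ * X = _]eq_bigr do rewrite real_normK ?num_real //.
  rewrite -mulNr; congr (_ * _); rewrite -[y ^+ 2]real_normK ?num_real //.
  have := upper_sqr xR; move: (up x) Rr `|y| => M r t h; lra.
have sz : Num.sqrt w * Num.sqrt (depth (x, w')) = `|z|.
  by rewrite -sqrtrM // zz sqrtr_sqr.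
rewrite /param hy /=; congr (_, _, _).
  by case: leP => h; [rewrite ger0_norm|rewrite ltr0_norm // opprK].
move: sz; rewrite {2 3}/w'; case: (leP 0 z) => h sz.
  by rewrite [X in _ - X]ler0_sqrtr ?oppr_le0 // subr0 sz ger0_norm.
by rewrite opprK [X in X - _]ler0_sqrtr ?oppr_le0 // sub0r mulNr sz ltr0_norm // opprK.
Qed.

End Param.

(** * Coincidences of the parametrisation *)

Section Collision.
Variables (R : realType) (g b : nat).
Local Notation pt := (R * R * R)%type.
Local Notation Rr := (Rg R g b).
Local Notation lw := (lower_arc g).
Local Notation up := (upper_arc g b).
Local Notation param := (param g b).
Local Notation in_rect := (in_rect g b).
Local Notation height := (height g b).

Lemma param_end a (u : R * R) : `|u.1| = Rr -> param a u = (u.1, 0, 0).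
Proof.
move=> /arcs_end[m0 M0]; rewrite /param /depth /height m0 M0.
by rewrite !(subrr, mul0r, mulr0, addr0, sqrtr0) oppr0; case: a.
Qed.

Lemma param_flip a a' (u : R * R) : height u = 0 -> param a u = param a' u.
Proof. by rewrite /param => ->; rewrite oppr0; case: a; case: a'. Qed.

(** The first coordinate determines x, and the second the height up to the side [a], hence [|w|].
    Changing the side forces height 0, that is a point of the x-axis. Changing the sign of [w]
    forces z = 0, so [qfun] vanishes: the point is on the outer circle, where w = 0 leaves no
    change, or on a hole, where |w| = 1. *)
Lemma param_collision a a' (u u' : R * R) : in_rect u -> in_rect u' ->
  param a u = param a' u' -> closed_surface g b (param a u) -> `|u.1| != Rr ->
  (a = a' /\ u = u') \/
  [/\ `|u.2| = 1, `|u'.2| = 1, a != a' -> lw u.1 = 0 &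
      u.2 != u'.2 -> exists2 i, (1 <= i <= g)%N & (u.1 - (4 * i)%:R) ^+ 2 <= 1].
Proof.
case: u u' => [x w] [x' w'] inu inu' /= [ex].
subst x'; move=> ey ez surf xe.
have [xR w1] := inu; have [_ w1'] := inu'; rewrite /= in xR w1 w1'.
have mM : lw x < up x by apply: lower_lt_upper; rewrite lt_neqAle xe.
have hole : w' = - w -> w != w' ->
    `|w| = 1 /\ exists2 i, (1 <= i <= g)%N & (x - (4 * i)%:R) ^+ 2 <= 1.
  move=> ew ne; have z0 : (param a (x, w)).2 = 0.
    rewrite /param /=; move: ez; rewrite ew opprK.
    have -> : depth g b (x, - w) = depth g b (x, w) by rewrite /depth /height /= normrN.
    by move=> ez; lra.
  have : (param a (x, w)).2 ^+ 2 +
    qfun g b x (if a then height (x, w) else - height (x, w)) = 0 by [].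
  rewrite z0 (_ : qfun _ _ _ _ = qfun g b x (height (x, w))); last first.
    by case: a {ey ez z0 surf} => //; rewrite !qfunE; under eq_bigr do rewrite sqrrN; rewrite sqrrN.
  rewrite expr0n /= add0r qfunE => /eqP; rewrite mulf_eq0 prodf_seq_eq0 => /orP[/eqP h|].
    have hM : height (x, w) = up x.
      apply/eqP; rewrite -(eqrXn2 (ltn0Sn 1)) ?sqrtr_ge0 //; last exact: height_ge0.
      by apply/eqP; rewrite upper_sqr //; lra.
    have w0 : `|w| = 0.
      move: hM mM; rewrite /height /=; move: (lw x) (up x) `|w| => m M t; nra.
    by move: ne; rewrite ew (normr0_eq0 w0) oppr0 eqxx.
  move=> /hasP[i]; rewrite mem_index_iota ltnS => ig /eqP h.
  have hm : height (x, w) = lw x.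
    apply/eqP; rewrite eq_le; have /andP[-> _] := height_bounds inu; rewrite andbT.
    apply: le_trans (hole_le_lower x ig); rewrite /hole_arc.
    rewrite -[leLHS]ger0_norm ?height_ge0 // -sqrtr_sqr ler_wsqrtr //; lra.
  split; last by exists i => //; have := sqr_ge0 (height (x, w)); lra.
  move: hm mM; rewrite /height /=; move: (lw x) (up x) `|w| => m M t; nra.
have [ea|na] := eqVneq a a'.
  subst a'; have eh : height (x, w) = height (x, w') by case: a ey {ez surf} => // /oppr_inj.
  have ew : `|w| = `|w'|.
    move: eh mM; rewrite /height /=; move: (lw x) (up x) `|w| `|w'| => m M t t'; nra.
  have [eww|ne] := eqVneq w w'; first by left; rewrite eww.
  right; have ew' : w' = - w.
    by move/eqP: ew; rewrite eqr_norm2 (negPf ne) /= => /eqP ->; rewrite opprK.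
  have [h1 h2] := hole ew' ne.
  by split=> //; rewrite -?ew.
have h0 : height (x, w) = 0 /\ height (x, w') = 0.
  have := height_ge0 inu; have := height_ge0 inu'.
  by move: na ey {ez surf}; case: a; case: a' => // _; lra.
have [h1 h2] := h0.
have m0 : lw x = 0.
  by have := lower_arc_ge0 g x; have /andP[] := height_bounds inu; rewrite /= h1; lra.
have nw t : height (x, t) = 0 -> `|t| = 1.
  move: mM; rewrite /height /= m0; move: (up x) `|t| => M s; nra.
right; split=> //; try exact: nw.
move=> ne; have [] // := hole _ ne.
have /eqP : `|w| = `|w'| by rewrite !nw.
by rewrite eqr_norm2 (negPf ne) /= => /eqP ->; rewrite opprK.
Qed.

(** Hole k ends at 4k + 1 and hole k + 1 starts at 4k + 3; the first and last gaps are
    open-ended. *)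
Lemma gap_interval (x : R) : lw x = 0 -> exists k, [/\ (k <= g)%N,
  k = 0%N \/ (4 * k + 1)%:R <= x & k = g \/ x <= (4 * k + 3)%:R].
Proof.
move=> m0.
have out i : (1 <= i <= g)%N -> 1 <= (x - (4 * i)%:R) ^+ 2.
  by move=> ig; have := hole_le_lower x ig; rewrite m0 leNgt sqrtr_gt0 subr_gt0 -leNgt.
elim: (g) out => [|n IHn] out; first by exists 0%N; split; [|left|left].
have [|k [kn lo hi]] := IHn.
  by move=> i /andP[i1 i2]; apply: out; rewrite i1 leqW.
have [ek|hi'] := hi; last by exists k; split=> //; [exact: leqW|right].
subst k; have := out n.+1; rewrite leqnn => /(_ isT) h.
have [le|gt] := leP x (4 * n + 3)%:R; first by exists n; split=> //; right.
exists n.+1; split=> //; [right|by left].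
rewrite leNgt; apply/negP => lt; move: h; rewrite leNgt => /negP[].
move: gt lt; rewrite !mulnS !natrD; move: ((4 * n)%:R : R) => c h1 h2; nra.
Qed.

End Collision.

(** * The grid and the traces of subsets of the surface *)

Section Grid.
Variables (R : realType) (g b N : nat).
Local Notation pt := (R * R * R)%type.
Local Notation Rr := (Rg R g b).
Local Notation Rn := (4 * (g + b) + 10)%N.
Local Notation lw := (lower_arc g).
Local Notation param := (param g b).
Local Notation in_rect := (in_rect g b).
Local Notation L := (N * (2 * Rn))%N.
Local Notation K := (2 * N)%N.
Local Notation V := ('I_L.+1 * (bool * 'I_K.+1))%type.

(* Column i is x = i/N - Rg and row k is w = k/N - 1. The runs of the x-axis are
   separated by the points x = 2r+1 (1 <= r <= 2g): even runs lie in the domain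
   (there the halves y >= 0 and y <= 0 meet), odd runs are diameters of the holes
   (there the two sheets meet). *)
Definition cut (r : nat) : nat :=
  (N * if r == 0 then 0 else if r <= g.*2 then Rn + 2 * r + 1 else 2 * Rn)%N.

Lemma cut_mono : {homo cut : r r' / (r <= r')%N}.
Proof.
move=> r r' h; rewrite /cut leq_mul2l; apply/orP; right.
by do 2!case: eqP => ?; case: (leqP r g.*2) => ?; case: (leqP r' g.*2) => ?; lia.
Qed.

Definition gx (u : R * R) : R := N%:R * (u.1 + Rr).
Definition gw (u : R * R) : R := N%:R * (u.2 + 1).

(* Vertices near a preimage of C under param, rather than near C itself: at points
   with several preimages this picks up every grid vertex needed for connectedness. *)
Definition trace (C : set pt) : {set V} :=
  [set v : V | `[< exists u, [/\ in_rect u, C (param v.2.1 u),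
     `|gx u - v.1%:R| <= 1 & `|gw u - v.2.2%:R| <= 1] >]]%SET.

Lemma traceP C (v : V) : reflect (exists u, [/\ in_rect u, C (param v.2.1 u),
     `|gx u - v.1%:R| <= 1 & `|gw u - v.2.2%:R| <= 1]) (v \in trace C).
Proof. by rewrite inE; apply: asboolP. Qed.

(** One weak and one strict bound keep i and j less than 2 apart, so a trace vertex, allowed at
    distance 1, is one grid step away from a strictly near vertex. *)
Lemma near_nat (x : R) (i j : nat) : `|x - i%:R| <= 1 -> `|x - j%:R| < 1 ->
  (i <= j.+1)%N /\ (j <= i.+1)%N.
Proof.
rewrite ler_norml ltr_norml => /andP[h1 h2] /andP[h3 h4].
split; rewrite -ltnS -(ltr_nat R) -!natr1; lra.
Qed.

(** Strictness prevents i from passing the integers c and c': a column strictly near a point of a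
    run belongs to that run and carries its rungs. *)
Lemma near_between (x : R) (i c c' : nat) : `|x - i%:R| < 1 -> c%:R <= x <= c'%:R ->
  (c <= i <= c')%N.
Proof.
rewrite ltr_norml => /andP[h1 h2] /andP[h3 h4].
by apply/andP; split; rewrite -ltnS -(ltr_nat R) -natr1; lra.
Qed.

Lemma near_exists (n : nat) (x : R) : 0 <= x <= n%:R -> exists i : 'I_n.+1, `|x - i%:R| < 1.
Proof.
move=> /andP[x0 xn]; have /andP[h1 h2] := Num.Theory.truncn_itv x0.
have tn : (Num.truncn x < n.+1)%N by rewrite ltnS -(ler_nat R); apply: le_trans h1 xn.
exists (Ordinal tn) => /=; rewrite ltr_norml; move: h2; rewrite -natr1; lra.
Qed.

Lemma gx_bounds u : in_rect u -> 0 <= gx u <= L%:R.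
Proof.
move=> [/ler_normlP[h1 h2] _]; rewrite /gx natrM natrM -/Rr.
have N0 : 0 <= N%:R :> R by apply: ler0n.
by rewrite mulr_ge0 ?ler_wpM2l //; lra.
Qed.

Lemma gw_bounds u : in_rect u -> 0 <= gw u <= K%:R.
Proof.
move=> [_ /ler_normlP[h1 h2]]; rewrite /gw natrM mulrC.
have N0 : 0 <= N%:R :> R by apply: ler0n.
by rewrite mulr_ge0 ?ler_wpM2r //; lra.
Qed.

Lemma trace_cover (C : set pt) p : closed_surface g b p -> C p ->
  exists2 v, v \in trace C & exists u, [/\ in_rect u, param v.2.1 u = p,
     `|gx u - v.1%:R| <= 1 & `|gw u - v.2.2%:R| <= 1].
Proof.
move=> /param_surj[a [u [inu pu]]] Cp.
have [i hi] := near_exists (gx_bounds inu); have [k hk] := near_exists (gw_bounds inu).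
by exists (i, (a, k)); [apply/traceP|]; exists u; rewrite /= pu !ltW.
Qed.

Local Notation conn C := (connect (@band_adj L K g cut (trace C))).

Lemma gap_run u (i : 'I_L.+1) : in_rect u -> lw u.1 = 0 -> `|gx u - i%:R| < 1 ->
  exists r : 'I_g.*2.+1, ~~ odd r /\ (cut r <= i <= cut r.+1)%N.
Proof.
move=> inu /gap_interval[k [kg lo hi]] ni.
have rg : (k.*2 < g.*2.+1)%N by lia.
exists (Ordinal rg); rewrite /= odd_double; split=> //.
apply: near_between ni _; have /andP[b0 b1] := gx_bounds inu.
have N0 : 0 <= N%:R :> R by apply: ler0n.
apply/andP; split.
  rewrite /cut; case: eqP => [_|k0]; first by rewrite muln0.
  rewrite leq_double kg.
  case: lo => [k00|lo]; first by lia.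
  rewrite natrM /gx ler_wpM2l // -addnA natrD addrC lerD2r.
  by rewrite (_ : 2 * k.*2 + 1 = 4 * k + 1)%N //; lia.
rewrite /cut /=; case: ltnP => [lt|ge]; last exact: b1.
case: hi => [kg'|hi]; first by lia.
rewrite natrM /gx ler_wpM2l // -addnA natrD addrC lerD2l.
by rewrite (_ : 2 * k.*2.+1 + 1 = 4 * k + 3)%N //; lia.
Qed.

Lemma hole_run u (i : 'I_L.+1) j : (1 <= j <= g)%N -> (u.1 - (4 * j)%:R) ^+ 2 <= 1 ->
  `|gx u - i%:R| < 1 ->
  exists r : 'I_g.*2.+1, odd r /\ (cut r <= i <= cut r.+1)%N.
Proof.
move=> /andP[j1 jg] /sqr_le1_bounds/andP[h1 h2] ni.
(* Run 2j - 1 goes from x = 4j - 1 to x = 4j + 1, the diameter of hole j; the gap following that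
   hole is run 2j. *)
have rg : (j.*2.-1 < g.*2.+1)%N by lia.
exists (Ordinal rg) => /=; rewrite -[j]prednK //= odd_double; split=> //.
apply: near_between ni _; have N0 : 0 <= N%:R :> R by apply: ler0n.
rewrite /cut /= (_ : (j.-1.*2.+1 <= g.*2)%N); last lia.
rewrite (_ : (j.-1.*2.+2 <= g.*2)%N); last lia.
rewrite !natrM /gx !ler_wpM2l //.
  rewrite -addnA natrD addrC lerD2l.
  rewrite (_ : 2 * j.-1.*2.+2 + 1 = 4 * j + 1)%N; last lia.
  by rewrite natrD; lra.
rewrite -addnA natrD addrC lerD2r.
rewrite (_ : 2 * j.-1.*2.+1 + 1 = 4 * j - 1)%N; last lia.
by rewrite natrB; [lra|lia].
Qed.

Lemma end_row u (k : 'I_K.+1) : `|u.2| = 1 -> `|gw u - k%:R| < 1 ->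
  k = row_end K (0 <= u.2).
Proof.
move=> /eqP; rewrite eqr_norml ler01 andbT /gw => /orP[] /eqP ->.
  rewrite ler01 (_ : N%:R * (1 + 1) = K%:R); last by rewrite natrM mulrC.
  move=> h; apply/val_inj => /=.
  by have := near_between (c := K) (c' := K) h; rewrite lexx => /(_ isT); lia.
rewrite ler0N1 addNr mulr0 => h; apply/val_inj => /=.
by have := near_between (c := 0%N) (c' := 0%N) h; rewrite lexx => /(_ isT); lia.
Qed.

Hypothesis N_gt0 : (0 < N)%N.

Section SamePoint.
Variables (C : set pt) (p : pt).
Hypothesis Cp : C p.
Hypothesis pS : closed_surface g b p.

Lemma trace_mem (a : bool) u (i : 'I_L.+1) (k : 'I_K.+1) : in_rect u -> param a u = p ->
  `|gx u - i%:R| <= 1 -> `|gw u - k%:R| <= 1 -> (i, (a, k)) \in trace C.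
Proof. by move=> inu pu h1 h2; apply/traceP; exists u; rewrite /= pu. Qed.

Lemma column_connect (i : 'I_L.+1) a : (forall k, (i, (a, k)) \in trace C) ->
  forall k k', conn C (i, (a, k)) (i, (a, k')).
Proof.
move=> all.
have from0 n (k : 'I_K.+1) : k = n :> nat -> conn C (i, (a, ord0)) (i, (a, k)).
  elim: n k => [|n IHn] k kn.
    by have -> : k = ord0 by apply/val_inj.
  have nK : (n < K.+1)%N by have := ltn_ord k; lia.
  apply: connect_trans (IHn (Ordinal nK) erefl) _.
  by apply: band_conn_row; rewrite ?all //=; lia.
move=> k k'; apply: connect_trans (from0 _ _ erefl).
by rewrite band_conn_sym; apply: from0.
Qed.

(** Two preimages of [p] share their x, so one column serves both. Equal preimages are joined along
    a path of the slice; otherwise a gap rung changes the side and a hole rung the sign of w. *)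
Lemma same_point_connect (a a' : bool) u u' (i : 'I_L.+1) (k k' : 'I_K.+1) :
  in_rect u -> in_rect u' -> param a u = p -> param a' u' = p ->
  `|gx u - i%:R| < 1 -> `|gw u - k%:R| < 1 -> `|gw u' - k'%:R| < 1 ->
  conn C (i, (a, k)) (i, (a', k')).
Proof.
move=> inu inu' pu pu' ni nk nk'.
have ex : u.1 = u'.1 by have [] : param a u = param a' u' by rewrite pu.
have gxu : gx u' = gx u by rewrite /gx ex.
have [xe|xe] := eqVneq `|u.1| Rr.
  (* The whole segment over this extreme x is mapped to [p], so every vertex of column [i] is in the
     trace. *)
  have pe a'' (k'' : 'I_K.+1) : (i, (a'', k'')) \in trace C.
    pose t : R := k''%:R / N%:R - 1.
    have N0 : 0 < N%:R :> R by rewrite ltr0n.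
    have gt : gw (u.1, t) = k''%:R by rewrite /gw /t /= subrK mulrCA divff ?mulr1 // gt_eqF.
    apply: (@trace_mem _ (u.1, t)); last by rewrite gt subrr normr0.
    - split; first by case: inu.
      rewrite /= ler_norml /t; have k0 : 0 <= k''%:R / N%:R :> R by rewrite divr_ge0 // ltW.
      have : k''%:R / N%:R <= 2 :> R.
        by rewrite ler_pdivrMr // -natrM ler_nat -ltnS.
      by lra.
    - by rewrite param_end // -pu param_end.
    - exact: ltW.
  have [m0 _] := arcs_end xe.
  have [r [ro ri]] := gap_run inu m0 ni.
  apply: connect_trans (column_connect (pe a) k (row_end K true)) _.
  apply: connect_trans (column_connect (pe a') (row_end K true) k').
  exact: band_conn_gap ro ri (pe _ _) (pe _ _).
have pp : param a u = param a' u' by rewrite pu.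
have pS' : closed_surface g b (param a u) by rewrite pu.
have [[ea eu]|[w1 w1' gap hole]] := param_collision inu inu' pp pS' xe.
  subst a' u'; have [h1 h2] := near_nat (ltW nk) nk'.
  by apply: band_conn_row h1 h2 _ _; apply: (@trace_mem _ u); rewrite // ltW.
have ek := end_row w1 nk; have ek' := end_row w1' nk'; subst k k'.
have mem1 : (i, (a, row_end K (0 <= u.2))) \in trace C.
  by apply: trace_mem (ltW ni) (ltW nk).
have mem3 : (i, (a', row_end K (0 <= u'.2))) \in trace C.
  by apply: trace_mem (ltW _) (ltW nk'); rewrite ?gxu.
have mem2 : (i, (a', row_end K (0 <= u.2))) \in trace C.
  have [<-//|na] := eqVneq a a'.
  apply: (@trace_mem _ u _ _ inu _ (ltW ni) (ltW nk)).
  by rewrite -pu; apply: param_flip; rewrite /height w1 gap // subrr mul0r addr0.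
apply: (@connect_trans _ _ (i, (a', row_end K (0 <= u.2)))).
  have [<-//|na] := eqVneq a a'.
  have [r [ro ri]] := gap_run inu (gap na) ni.
  exact: band_conn_gap ro ri mem1 mem2.
have [eu|nu] := eqVneq u.2 u'.2; first by rewrite -eu.
have [j jg hj] := hole nu.
have [r [ro ri]] := hole_run jg hj ni.
exact: band_conn_hole ro ri mem2 mem3.
Qed.

(** Both vertices are moved, inside the trace, to a common column [i0] and to strictly near rows,
    where the preceding lemma applies. *)
Lemma near_connect (v v' : V) u u' : in_rect u -> in_rect u' ->
  param v.2.1 u = p -> param v'.2.1 u' = p ->
  `|gx u - v.1%:R| <= 1 -> `|gw u - v.2.2%:R| <= 1 ->
  `|gx u' - v'.1%:R| <= 1 -> `|gw u' - v'.2.2%:R| <= 1 -> conn C v v'.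
Proof.
case: v v' => [i [a k]] [i' [a' k']] /= inu inu' pu pu' ni nk ni' nk'.
have ex : u.1 = u'.1 by have [] : param a u = param a' u' by rewrite pu.
have gxu : gx u' = gx u by rewrite /gx ex.
have [i0 hi0] := near_exists (gx_bounds inu).
have [k0 hk0] := near_exists (gw_bounds inu).
have [k1 hk1] := near_exists (gw_bounds inu').
have half (a0 : bool) u0 (i1 : 'I_L.+1) (l l0 : 'I_K.+1) :
    in_rect u0 -> param a0 u0 = p -> gx u0 = gx u ->
    `|gx u - i1%:R| <= 1 -> `|gw u0 - l%:R| <= 1 -> `|gw u0 - l0%:R| < 1 ->
    conn C (i1, (a0, l)) (i0, (a0, l0)).
  move=> in0 p0 g0 n1 nl nl0.
  apply: (@connect_trans _ _ (i0, (a0, l))).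
    have [h1 h2] := near_nat n1 hi0.
    by apply: band_conn_col => //; apply: (@trace_mem _ u0) => //; rewrite g0 // ltW.
  have [h1 h2] := near_nat nl nl0.
  by apply: band_conn_row => //; apply: (@trace_mem _ u0) => //; rewrite ?g0 ltW.
apply: connect_trans (half _ _ _ _ _ inu pu erefl ni nk hk0) _.
apply: connect_trans (same_point_connect inu inu' pu pu' hi0 hk0 hk1) _.
rewrite gxu in ni'.
by rewrite band_conn_sym; exact: (half _ _ _ _ _ inu' pu' gxu ni' nk' hk1).
Qed.

End SamePoint.

End Grid.

(** * Topology of the parametrisation *)

Section Continuity.
Variables (R : realType) (T : topologicalType).
Implicit Types f g : T -> R.

Lemma contD f g : continuous f -> continuous g -> continuous (fun x => f x + g x).
Proof. by move=> cf cg x; apply: cvgD; [apply: cf|apply: cg]. Qed.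

Lemma contN f : continuous f -> continuous (fun x => - f x).
Proof. by move=> cf x; apply: cvgN; apply: cf. Qed.

Lemma contM f g : continuous f -> continuous g -> continuous (fun x => f x * g x).
Proof. by move=> cf cg x; apply: cvgM; [apply: cf|apply: cg]. Qed.

Lemma cont_sqr f : continuous f -> continuous (fun x => f x ^+ 2).
Proof. by move=> cf; apply: contM. Qed.

Lemma cont_cst (c : R) : continuous (fun _ : T => c).
Proof. exact: cst_continuous. Qed.

Lemma cont_sqrt f : continuous f -> continuous (fun x => Num.sqrt (f x)).
Proof. by move=> cf x; apply: continuous_comp; [apply: cf|apply: sqrt_continuous]. Qed.

Lemma cont_norm f : continuous f -> continuous (fun x => `|f x|).
Proof. by move=> cf x; apply: cvg_norm; apply: cf. Qed.

Lemma cont_max f g : continuous f -> continuous g -> continuous (fun x => Num.max (f x) (g x)).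
Proof. by move=> cf cg x; apply: (@continuous_max _ _ f g); [apply: cf|apply: cg]. Qed.

Lemma cont_prod (s : seq nat) (F : nat -> T -> R) : (forall i, continuous (F i)) ->
  continuous (fun x => \prod_(i <- s) F i x).
Proof.
move=> cF; elim: s => [|i s IHs].
  by under eq_fun do rewrite big_nil; apply: cont_cst.
by under eq_fun do rewrite big_cons; apply: contM.
Qed.

Lemma cont_pair (U W : topologicalType) (f : T -> U) (g : T -> W) :
  continuous f -> continuous g -> continuous (fun x => (f x, g x)).
Proof. by move=> cf cg x; apply: cvg_pair; [apply: cf|apply: cg]. Qed.

End Continuity.

Section ParamTopology.
Variables (R : realType) (g b : nat).
Local Notation pt := (R * R * R)%type.
Local Notation Rr := (Rg R g b).

Lemma lower_arc_continuous n : continuous (@lower_arc R n).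
Proof.
elim: n => [|n IHn]; first exact: cont_cst.
apply: cont_max => //; apply: cont_sqrt; apply: contD; first exact: cont_cst.
apply: contN; apply: cont_sqr; apply: contD; last exact: cont_cst.
by move=> x; apply: cvg_id.
Qed.

Lemma upper_arc_continuous : continuous (@upper_arc R g b).
Proof.
apply: cont_sqrt; apply: contD; first exact: cont_cst.
by apply: contN; apply: cont_sqr => x; apply: cvg_id.
Qed.

Let fst_cont : continuous (@fst R R).
Proof. by move=> x; apply: cvg_fst. Qed.
Let snd_cont : continuous (@snd R R).
Proof. by move=> x; apply: cvg_snd. Qed.
Let lw_cont : continuous (fun u : R * R => lower_arc g u.1).
Proof. by move=> x; apply: continuous_comp; [apply: fst_cont|apply: lower_arc_continuous]. Qed.
Let up_cont : continuous (fun u : R * R => upper_arc g b u.1).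
Proof. by move=> x; apply: continuous_comp; [apply: fst_cont|apply: upper_arc_continuous]. Qed.

Lemma height_continuous : continuous (@height R g b).
Proof.
apply: contD => //; apply: contM; last by apply: contD => //; apply: contN.
by apply: contD; [exact: cont_cst|apply: contN; apply: cont_norm].
Qed.

Lemma depth_continuous : continuous (@depth R g b).
Proof.
apply: contM.
  apply: contM; first by apply: contD => //; apply: contN.
  by apply: contD => //; apply: height_continuous.
apply: cont_prod => i; apply: contD; last exact: cont_cst.
apply: contD; last by apply: cont_sqr; apply: height_continuous.
by apply: cont_sqr; apply: contD => //; apply: cont_cst.
Qed.

Lemma param_continuous a : continuous (@param R g b a).
Proof.
apply: cont_pair; first apply: cont_pair => //.
  by case: a; [|apply: contN]; apply: height_continuous.
apply: contM; last by apply: cont_sqrt; apply: depth_continuous.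
by apply: contD; [|apply: contN]; apply: cont_sqrt => //; apply: contN.
Qed.

Lemma in_rect_compact : compact [set u : R * R | in_rect g b u].
Proof.
rewrite (_ : [set u | _] = `[- Rr, Rr] `*` `[-1, 1]); last first.
  apply/seteqP; split=> -[x w] /=; rewrite /in_rect /= !in_itv /= !ler_norml.
    by case.
  by case.
by apply: compact_setX; apply: segment_compact.
Qed.

(** * Disjointness and connectedness of traces *)

Lemma compact_separated (A B : set (R * R)) : compact A -> compact B -> A `&` B = set0 ->
  exists2 e : R, 0 < e & forall u v, A u -> B v -> e <= `|u.1 - v.1| + `|u.2 - v.2|.
Proof.
move=> cA cB AB.
have [[uv0 AB0]|no] := pselect (A `*` B !=set0); last first.
  by exists 1 => // u v Au Bv; exfalso; apply: no; exists (u, v).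
pose d (w : (R * R) * (R * R)) := `|w.1.1 - w.2.1| + `|w.1.2 - w.2.2|.
have d_cont : continuous d.
  have c1 : continuous (@fst (R * R) (R * R)) by move=> x; apply: cvg_fst.
  have c2 : continuous (@snd (R * R) (R * R)) by move=> x; apply: cvg_snd.
  apply: contD; apply: cont_norm; apply: contD.
  - by move=> x; apply: continuous_comp; [apply: c1|apply: fst_cont].
  - by apply: contN => x; apply: continuous_comp; [apply: c2|apply: fst_cont].
  - by move=> x; apply: continuous_comp; [apply: c1|apply: snd_cont].
  - by apply: contN => x; apply: continuous_comp; [apply: c2|apply: snd_cont].
have [||c] := @compact_EVT_min _ R d (A `*` B) _ (compact_setX cA cB).
- by exists uv0.
- exact: continuous_subspaceT.
rewrite inE => -[Ac Bc] min; exists (d c); last first.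
  by move=> u v Au Bv; apply: (min (u, v)); rewrite inE.
rewrite lt_def addr_ge0 // andbT paddr_eq0 // !normr_eq0 !subr_eq0.
apply/negP => /andP[/eqP e1 /eqP e2]; have : (A `&` B) c.1.
  split=> //; suff -> : c.1 = c.2 by [].
  by case: (c.1) (c.2) e1 e2 => ? ? [? ?] /= -> ->.
by rewrite AB.
Qed.

(** A common vertex fixes the side [a], and on each side the preimages of the two sets are disjoint
    compacts, at distance at least some e > 0. Points near the same vertex differ by at most 2/N in
    each of two coordinates, so N > 4/e excludes a common vertex. *)
Lemma trace_disjoint (C1 C2 : set pt) : compact C1 -> compact C2 -> C1 `&` C2 = set0 ->
  exists N0, forall N, (N0 <= N)%N ->
    forall v, v \in trace g b N C1 -> v \in trace g b N C2 -> False.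
Proof.
move=> c1 c2 C12.
have hs : hausdorff_space pt by apply: norm_hausdorff.
pose D C a := [set u : R * R | in_rect g b u] `&` param g b a @^-1` C.
have cD C a : compact C -> compact (D C a).
  move=> cC; apply: compact_closedI; first exact: in_rect_compact.
  apply: closed_comp; last exact: compact_closed.
  by move=> x _; apply: param_continuous.
have sep a : exists2 e : R, 0 < e &
    forall u v, D C1 a u -> D C2 a v -> e <= `|u.1 - v.1| + `|u.2 - v.2|.
  apply: compact_separated; [exact: cD|exact: cD|].
  apply/seteqP; split=> // u [[_ p1] [_ p2]].
  by have : (C1 `&` C2) (param g b a u) by []; rewrite C12.
have [e1 e10 h1] := sep true; have [e2 e20 h2] := sep false.
pose e := Num.min e1 e2.
have e0 : 0 < e by rewrite lt_min e10.
have he a u v : D C1 a u -> D C2 a v -> e <= `|u.1 - v.1| + `|u.2 - v.2|.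
  by case: a => d1 d2; rewrite ge_min ?(h1 _ _ d1 d2) ?(h2 _ _ d1 d2) ?orbT.
exists (Num.bound (4 / e)) => N hN v /traceP[u [inu Cu x1 w1]] /traceP[u' [inu' Cu' x2 w2]].
have := he _ _ _ (conj inu Cu) (conj inu' Cu').
have big : 4 < N%:R * e.
  rewrite -ltr_pdivrMr //; apply: lt_le_trans (archi_boundP _) _; last by rewrite ler_nat.
  by rewrite divr_ge0 // ltW.
have N0 : 0 < N%:R :> R.
  by rewrite -(pmulr_lgt0 _ e0); apply: lt_trans big.
have close (s t c c' : R) : `|N%:R * (s + c) - c'| <= 1 -> `|N%:R * (t + c) - c'| <= 1 ->
    N%:R * `|s - t| <= 2.
  move=> ns nt; rewrite -[N%:R]gtr0_norm // -normrM.
  have -> : N%:R * (s - t) = (N%:R * (s + c) - c') - (N%:R * (t + c) - c') by ring.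
  by apply: le_trans (ler_normB _ _) _; lra.
have k1 := close _ _ _ _ x1 x2; have k2 := close _ _ _ _ w1 w2.
rewrite leNgt => /negP[]; rewrite -(ltr_pM2l N0) mulrDr; lra.
Qed.

(** The images of the closed grid squares around trace vertices form a finite closed cover of [C].
    Those in the component of [v0] and the others have closed unions that do not meet on [C], as
    vertices whose stars share a point of [C] are linked; connectedness of [C] leaves only the first
    union. *)
Lemma trace_connected N (C : set pt) : (0 < N)%N -> C `<=` closed_surface g b ->
  connected C ->
  @band_connected _ _ g (cut g b N) (trace g b N C).
Proof.
move=> N0 CS conC v0 v1 v0C v1C.
have hs : hausdorff_space pt by apply: norm_hausdorff.
set badj := band_adj _ _ _.
pose star (v : 'I_(N * (2 * (4 * (g + b) + 10))).+1 * (bool * 'I_(2 * N).+1)) : set pt :=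
  param g b v.2.1 @` ([set u | in_rect g b u] `&`
  [set u | `|gx g b N u - v.1%:R| <= 1 /\ `|gw N u - v.2.2%:R| <= 1]).
have gx_cont : continuous (@gx R g b N).
  by apply: contM; [exact: cont_cst|apply: contD => //; apply: cont_cst].
have gw_cont : continuous (@gw R N).
  by apply: contM; [exact: cont_cst|apply: contD => //; apply: cont_cst].
have cle (f : R * R -> R) c : continuous f -> closed [set u | `|f u - c| <= 1].
  move=> cf; apply: (@closed_comp _ _ (fun u => `|f u - c|) [set x | x <= 1]).
    by move=> x _; apply: cont_norm; apply: contD => //; apply: cont_cst.
  exact: closed_le.
have star_closed v : closed (star v).
  apply: compact_closed => //; apply: continuous_compact.
    by apply: continuous_subspaceT; apply: param_continuous.
  apply: compact_closedI; first exact: in_rect_compact.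
  by apply: closedI; apply: cle.
pose K1 v := connect badj v0 v && (v \in trace g b N C).
pose K2 v := ~~ connect badj v0 v && (v \in trace g b N C).
pose U (P : pred _) := \bigcup_(v in [set v | P v]) star v.
have U_closed P : closed (U P).
  by apply: closed_bigcup => //; apply: finite_finset.
have star_conn v v' p : C p -> star v p -> star v' p -> connect badj v v'.
  move=> Cp [u [inu [nx nw]] pu] [u' [inu' [nx' nw']] pu'].
  exact: (near_connect N0 Cp (CS _ Cp) inu inu' pu pu' nx nw nx' nw').
have cover p : C p -> exists2 v, v \in trace g b N C & star v p.
  move=> Cp; have [v vC [u [inu pu h1 h2]]] := trace_cover N (CS _ Cp) Cp.
  by exists v => //; exists u.
have CU : C `&` U K1 = C.
  apply: conC.
  - have /traceP[u [inu Cu h1 h2]] := v0C.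
    exists (param g b v0.2.1 u); split=> //; exists v0; last by exists u.
    by rewrite /= /K1 connect0.
  - exists (~` U K2); first by rewrite openC.
    apply/seteqP; split=> p [Cp].
      move=> [v /andP[cv vC] sv]; split=> // -[v' /andP[ncv' _] sv'].
      by move/negP: ncv'; apply; apply: connect_trans cv (star_conn _ _ _ Cp sv sv').
    move=> nU; split=> //; have [v vC sv] := cover p Cp.
    exists v => //; apply/andP; split=> //; apply/negPn/negP => ncv.
    by apply: nU; exists v => //; rewrite /= /K2 ncv.
  - by exists (U K1).
have /traceP[u [inu Cu h1 h2]] := v1C.
have : (C `&` U K1) (param g b v1.2.1 u) by rewrite CU.
move=> [_ [v /andP[cv _] sv]]; apply: connect_trans cv _.
by apply: (star_conn _ _ _ Cu sv); exists u.
Qed.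

Lemma loop_image (S : set pt) gam : loop_in S gam ->
  [/\ compact (gam @` @I01 R), connected (gam @` @I01 R) & gam @` @I01 R `<=` S].
Proof.
have -> : @I01 R = `[0, 1]%classic.
  by apply/seteqP; split=> x /=; rewrite /I01 /= in_itv.
move=> [gc _ gS]; split.
- by apply: continuous_compact => //; apply: segment_compact.
- by apply: connected_continuous_connected => //; apply: segment_connected.
- by move=> p [t t01 <-]; apply: gS.
Qed.

End ParamTopology.

(** * The obstruction and the conclusion *)

(* The complement of the 1-subdivision of the complete bipartite graph. *)
Definition string_obstruction (m : nat) : rel (bool * 'I_m.+1 + 'I_m.+1 * 'I_m.+1) :=
  fun x y => match x, y with
  | inl l, inl l' => l != l'
  | inr p, inr p' => p != p'
  | inl l, inr p | inr p, inl l => (l != (true, p.1)) && (l != (false, p.2))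
  end.

Theorem theorem1p7 (R : realType) (g b : nat) :
  exists (V : finType) (e : rel V),
    [/\ symmetric e, irreflexive e &
        ~ induced_subgraph_of_fine_curve_graph R g b e].
Proof.
(* The final bound amounts to m (m - 4) <= 12g + 8, which fails by a wide margin for this value. *)
pose m := (12 * g + 20)%N.
exists (bool * 'I_m.+1 + 'I_m.+1 * 'I_m.+1)%type, (@string_obstruction m); split.
- by move=> [l|p] [l'|p'] //=; rewrite eq_sym.
- by move=> [l|p] /=; rewrite eqxx.
move=> [f [f_inj f_ess f_adj]].
have fP x : [/\ compact (f x), connected (f x) & f x `<=` closed_surface g b].
  have [gam [[lp _] <- _ _]] := f_ess x.
  have [h1 h2 h3] := loop_image lp; split=> // p /h3; by case.
have f_disj x y : string_obstruction x y -> f x `&` f y = set0.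
  by move=> /f_adj[].
(* Injectivity rules out equal curves, so non-adjacency leaves intersection as the only
   possibility. *)
have f_meet x y : x != y -> ~~ string_obstruction x y -> f x `&` f y !=set0.
  move=> nxy ne; apply/set0P/eqP => fxy; move/negP: ne; apply; apply/f_adj.
  by split=> // /f_inj /eqP; rewrite (negPf nxy).
have sep xy : exists N0, forall N, (N0 <= N)%N -> string_obstruction xy.1 xy.2 ->
    forall v, v \in trace g b N (f xy.1) -> v \in trace g b N (f xy.2) -> False.
  have [c1 _ _] := fP xy.1; have [c2 _ _] := fP xy.2.
  have [e|ne] := boolP (string_obstruction xy.1 xy.2); last by exists 0%N.
  have [N0 h] := trace_disjoint g b c1 c2 (f_disj _ _ e).
  by exists N0 => N hN _; apply: h.
have [N0 N0P] := fin_all_exists sep.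
(* A single mesh fine enough for all pairs at once; the successor makes it positive. *)
pose N := (\max_xy N0 xy).+1.
have tr_disj x y v : v \in trace g b N (f x) -> v \in trace g b N (f y) ->
    ~~ string_obstruction x y.
  move=> vx vy; apply/negP => e; apply: (N0P (x, y) N _ e v vx vy).
  by apply: leqW; apply: (leq_bigmax (x, y)).
have tr_conn x : @band_connected _ _ g (cut g b N) (trace g b N (f x)).
  by have [_ h1 h2] := fP x; apply: trace_connected.
have := @band_string_bound _ _ g (cut g b N) _ (@cut_mono g b N) m
  (fun l => trace g b N (f (inl l))) (fun p => trace g b N (f (inr p))).
suff H : (3 * m ^ 2 <= 12 * g + 6 + 2 * m.+1 ^ 2)%N -> False.
  move=> h; apply/H/h; clear h H.
  - by [].
  - by move=> l; apply: tr_conn.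
  - by move=> p; apply: tr_conn.
  - by move=> l l' v vl vl'; have /= := tr_disj _ _ _ vl vl'; rewrite negbK => /eqP.
  - by move=> p p' v vp vp'; have /= := tr_disj _ _ _ vp vp'; rewrite negbK => /eqP.
  - move=> l p v vl vp; have /= := tr_disj _ _ _ vl vp.
    by rewrite negb_and !negbK => /orP[] /eqP; [left|right].
  - move=> p b'; set l := (b', _).
    have [] := @f_meet (inl l) (inr p); first by [].
      by rewrite /= /l; case: b' {l} => /=; rewrite eqxx ?andbF.
    move=> q [q1 q2]; have [_ _ S] := fP (inl l).
    (* The same preimage [u] of the common point [q] places [v] in both traces. *)
    have [v vl [u [inu pu h1 h2]]] := trace_cover N (S _ q1) q1.
    exists v; split=> //; apply/traceP; exists u; split=> //; by rewrite pu.
rewrite /m; nia.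
Qed.
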